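(* Modulo the genus-1 relation $$( * )\qquad B(\mathcal{W}_1,\mathcal{W}_2,T(\mathcal{V}))=A_2(\mathcal{W}_1\bullet\mathcal{W}_2,\mathcal{V})-(\nabla_{\mathcal{W}_1\bullet\mathcal{W}_2}A_1)(\mathcal{V})\quad\text{for all vector fields }\mathcal{W}_1,\mathcal{W}_2,\mathcal{V},$$ the genus-2 topological recursion relation $$\text{(II)}\qquad \langle\langle T(\mathcal{W})\,T(\mathcal{V})\rangle\rangle_2-3\langle\langle T(\mathcal{W}\bullet\mathcal{V})\rangle\rangle_2=A_2(\mathcal{W},\mathcal{V})\quad\text{for all }\mathcal{W},\mathcal{V}$$ is a formal consequence of the topological recursion relations $$\text{(I)}\qquad \langle\langle T^2(\mathcal{W})\rangle\rangle_2=A_1(\mathcal{W})\quad\text{for all }\mathcal{W}$$ and $$\text{(III)}\qquad 2\langle\langle\{\mathcal{W}_1\bullet\mathcal{W}_2\bullet\mathcal{W}_3\}\rangle\rangle_2-2\langle\langle\mathcal{W}_1\,\mathcal{W}_2\,\mathcal{W}_3\,\gamma^\alpha\rangle\rangle_0\langle\langle T(\gamma_\alpha)\rangle\rangle_2+\sum_{i=1}^3\Big\{\langle\langle\mathcal{W}_i\;T(\mathcal{W}_j\bullet\mathcal{W}_k)\rangle\rangle_2-\langle\langle T(\mathcal{W}_i)\;\{\mathcal{W}_j\bullet\mathcal{W}_k\}\rangle\rangle_2\Big\}=B(\mathcal{W}_1,\mathcal{W}_2,\mathcal{W}_3)\quad\text{for all }\mathcal{W}_1,\mathcal{W}_2,\mathcal{W}_3,$$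 where in the sum $\{j,k\}=\{1,2,3\}\setminus\{i\}$. That is, given $( * )$, if (I) and (III) hold for all vector fields, then (II) holds for all vector fields.
   Context: $V$ is a smooth projective variety with $H^{\rm odd}(V;\mathbb{C})=0$; $\gamma_1,\dots,\gamma_N$ is a basis of $H^*(V;\mathbb{C})$ with $\gamma_1$ the identity of the ordinary cohomology ring; $\eta_{\alpha\beta}=\int_V\gamma_\alpha\cup\gamma_\beta$, $(\eta^{\alpha\beta})=(\eta_{\alpha\beta})^{-1}$, $\gamma^\alpha=\eta^{\alpha\beta}\gamma_\beta$; repeated indices are summed. $F_g=\sum_{k\ge0}\frac1{k!}\sum t^{\alpha_1}_{n_1}\cdots t^{\alpha_k}_{n_k}\langle\tau_{n_1}(\gamma_{\alpha_1})\cdots\tau_{n_k}(\gamma_{\alpha_k})\rangle_g$ is the generating function of genus-$g$ descendant Gromov-Witten invariants, a formal power series in the coordinates $t^\alpha_n$ ($n\ge0$) of the big phase space; $\tilde t^\alpha_m=t^\alpha_m-\delta_{m,1}\delta_{\alpha,1}$. $\tau_n(\gamma_\alpha)$ is identified with $\partial/\partial t^\alpha_n$; $\gamma_\alpha=\tau_0(\gamma_\alpha)$, $\tau_n(\gamma_\alpha)=0$ for $n<0$. For (formal) vector fields $\mathcal{W}_i=\sum f^i_{m,\alpha}\tau_m(\gamma_\alpha)$, $\langle\langle\mathcal{W}_1\cdots\mathcal{W}_k\rangle\rangle_g=\sum f^1_{m_1,\alpha_1}\cdots f^k_{m_k,\alpha_k}\frac{\partial^kF_g}{\partial t^{\alpha_1}_{m_1}\cdots\partial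 t^{\alpha_k}_{m_k}}$. Quantum product: $\mathcal{U}\bullet\mathcal{W}=\langle\langle\mathcal{U}\,\mathcal{W}\,\gamma^\alpha\rangle\rangle_0\gamma_\alpha$. For $\mathcal{W}=\sum f_{m,\alpha}\tau_m(\gamma_\alpha)$: $T(\mathcal{W})=\sum f_{m,\alpha}\tau_{m+1}(\gamma_\alpha)-\langle\langle\mathcal{W}\,\gamma^\alpha\rangle\rangle_0\gamma_\alpha$, $T^2(\mathcal{W})=T(T(\mathcal{W}))$; $\nabla_{\mathcal{V}}\mathcal{W}=\sum(\mathcal{V}f_{m,\alpha})\tau_m(\gamma_\alpha)$ and $(\nabla_{\mathcal{W}}A_1)(\mathcal{V})=\mathcal{W}(A_1(\mathcal{V}))-A_1(\nabla_{\mathcal{W}}\mathcal{V})$. ''Formal consequence'' is meant relative to the universal properties: the string equation $\langle\langle\mathcal{S}\rangle\rangle_g=\frac12\delta_{g,0}\eta_{\alpha\beta}t^\alpha_0t^\beta_0$ with $\mathcal{S}=-\sum\tilde t^\alpha_m\tau_{m-1}(\gamma_\alpha)$; the dilaton equation $\langle\langle\mathcal{D}\rangle\rangle_g=(2g-2)F_g+\frac1{24}\chi(V)\delta_{g,1}$ with $\mathcal{D}=-\sum\tilde t^\alpha_m\tau_m(\gamma_\alpha)$; the genus-0 topological recursion relation $T(\mathcal{W})\bullet\mathcal{V}=0$ for all $\mathcal{W},\mathcal{V}$ (which implies associativity of $\bullet$); the genus-1 topological recursion relation $\langle\langle T(\mathcal{W})\rangle\rangle_1=\frac1{24}\langle\langle\mathcal{W}\,\gamma^\mu\,\gamma_\mu\rangle\rangle_0$;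 and known relations among genus-0 and genus-1 data. The tensors $A_1,A_2,B$, which involve only genus-0 and genus-1 data: $A_1(\mathcal{W})=\frac7{10}\langle\langle\gamma_\alpha\rangle\rangle_1\langle\langle\{\gamma^\alpha\bullet\mathcal{W}\}\rangle\rangle_1+\frac1{10}\langle\langle\gamma_\alpha\,\{\gamma^\alpha\bullet\mathcal{W}\}\rangle\rangle_1-\frac1{240}\langle\langle\mathcal{W}\,\{\gamma_\alpha\bullet\gamma^\alpha\}\rangle\rangle_1+\frac{13}{240}\langle\langle\mathcal{W}\,\gamma_\alpha\,\gamma^\alpha\,\gamma^\beta\rangle\rangle_0\langle\langle\gamma_\beta\rangle\rangle_1+\frac1{960}\langle\langle\mathcal{W}\,\gamma^\alpha\,\gamma_\alpha\,\gamma^\beta\,\gamma_\beta\rangle\rangle_0$. $A_2(\mathcal{W},\mathcal{V})=\frac{13}{10}\langle\langle\mathcal{W}\,\mathcal{V}\,\gamma^\alpha\,\gamma^\beta\rangle\rangle_0\langle\langle\gamma_\alpha\rangle\rangle_1\langle\langle\gamma_\beta\rangle\rangle_1+\frac45\langle\langle\mathcal{W}\,\gamma^\alpha\rangle\rangle_1\langle\langle\{\gamma_\alpha\bullet\mathcal{V}\}\rangle\rangle_1+\frac45\langle\langle\mathcal{V}\,\gamma^\alpha\rangle\rangle_1\langle\langle\{\gamma_\alpha\bullet\mathcal{W}\}\rangle\rangle_1-\frac45\langle\langle\{\mathcal{W}\bullet\mathcal{V}\}\,\gamma^\alpha\rangle\rangle_1\langle\langle\gamma_\alpha\rangle\ra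ngle_1+\frac{23}{240}\langle\langle\mathcal{W}\,\mathcal{V}\,\gamma^\alpha\,\gamma_\alpha\,\gamma^\beta\rangle\rangle_0\langle\langle\gamma_\beta\rangle\rangle_1+\frac1{48}\langle\langle\mathcal{W}\,\gamma^\alpha\,\gamma_\alpha\,\gamma^\beta\rangle\rangle_0\langle\langle\gamma_\beta\,\mathcal{V}\rangle\rangle_1+\frac1{48}\langle\langle\mathcal{V}\,\gamma^\alpha\,\gamma_\alpha\,\gamma^\beta\rangle\rangle_0\langle\langle\gamma_\beta\,\mathcal{W}\rangle\rangle_1-\frac1{80}\langle\langle\mathcal{W}\,\mathcal{V}\,\{\gamma^\alpha\bullet\gamma_\alpha\}\rangle\rangle_1+\frac7{30}\langle\langle\mathcal{W}\,\mathcal{V}\,\gamma^\alpha\,\gamma^\beta\rangle\rangle_0\langle\langle\gamma_\alpha\,\gamma_\beta\rangle\rangle_1+\frac1{30}\langle\langle\gamma_\alpha\,\{\gamma^\alpha\bullet\mathcal{W}\}\,\mathcal{V}\rangle\rangle_1+\frac1{30}\langle\langle\gamma_\alpha\,\{\gamma^\alpha\bullet\mathcal{V}\}\,\mathcal{W}\rangle\rangle_1-\frac1{30}\langle\langle\{\mathcal{W}\bullet\mathcal{V}\}\,\gamma_\alpha\,\gamma^\alpha\rangle\rangle_1+\frac1{576}\langle\langle\mathcal{W}\,\mathcal{V}\,\gamma^\alpha\,\gamma_\alpha\,\gamma^\beta\,\gamma_\beta\rangle\rangle_0$. $B(\mathcal{W}_1,\mathcal{W}_2,\mathcal{W}_3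)=\frac15\langle\langle\mathcal{W}_1\mathcal{W}_2\mathcal{W}_3\gamma^\alpha\gamma^\beta\rangle\rangle_0\langle\langle\gamma_\alpha\rangle\rangle_1\langle\langle\gamma_\beta\rangle\rangle_1-\frac65\langle\langle\mathcal{W}_1\mathcal{W}_2\mathcal{W}_3\gamma^\alpha\rangle\rangle_0\langle\langle\gamma_\alpha\gamma^\beta\rangle\rangle_1\langle\langle\gamma_\beta\rangle\rangle_1+\frac1{120}\langle\langle\mathcal{W}_1\mathcal{W}_2\mathcal{W}_3\gamma^\alpha\gamma_\alpha\gamma^\beta\rangle\rangle_0\langle\langle\gamma_\beta\rangle\rangle_1-\frac1{120}\langle\langle\mathcal{W}_1\mathcal{W}_2\mathcal{W}_3\{\gamma^\alpha\bullet\gamma_\alpha\}\rangle\rangle_1+\frac1{10}\langle\langle\mathcal{W}_1\mathcal{W}_2\mathcal{W}_3\gamma^\alpha\gamma^\beta\rangle\rangle_0\langle\langle\gamma_\alpha\gamma_\beta\rangle\rangle_1-\frac1{20}\langle\langle\mathcal{W}_1\mathcal{W}_2\mathcal{W}_3\gamma^\alpha\rangle\rangle_0\langle\langle\gamma_\alpha\gamma^\beta\gamma_\beta\rangle\rangle_1+\sum_{\sigma\in S_3}\Big\{-\frac15\langle\langle\mathcal{W}_{\sigma(1)}\mathcal{W}_{\sigma(2)}\gamma^\alpha\gamma^\beta\rangle\rangle_0\langle\langle\gamma_\alpha\rangle\rangle_1\langle\langle\gamma_\beta\mathcal{W}_{\sigma(3)}\rangle\rangle_1+\frac25\langle\lan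gle\{\mathcal{W}_{\sigma(1)}\bullet\gamma_\alpha\}\rangle\rangle_1\langle\langle\gamma^\alpha\mathcal{W}_{\sigma(2)}\mathcal{W}_{\sigma(3)}\rangle\rangle_1-\frac35\langle\langle\mathcal{W}_{\sigma(1)}\{\mathcal{W}_{\sigma(2)}\bullet\gamma^\alpha\}\rangle\rangle_1\langle\langle\gamma_\alpha\mathcal{W}_{\sigma(3)}\rangle\rangle_1+\frac3{10}\langle\langle\mathcal{W}_{\sigma(1)}\gamma_\alpha\rangle\rangle_1\langle\langle\gamma^\alpha\{\mathcal{W}_{\sigma(2)}\bullet\mathcal{W}_{\sigma(3)}\}\rangle\rangle_1-\frac15\langle\langle\gamma_\alpha\rangle\rangle_1\langle\langle\gamma^\alpha\mathcal{W}_{\sigma(1)}\{\mathcal{W}_{\sigma(2)}\bullet\mathcal{W}_{\sigma(3)}\}\rangle\rangle_1-\frac1{80}\langle\langle\mathcal{W}_{\sigma(1)}\mathcal{W}_{\sigma(2)}\gamma^\alpha\gamma_\alpha\gamma^\beta\rangle\rangle_0\langle\langle\gamma_\beta\mathcal{W}_{\sigma(3)}\rangle\rangle_1+\frac1{80}\langle\langle\mathcal{W}_{\sigma(1)}\gamma^\alpha\gamma_\alpha\gamma^\beta\rangle\rangle_0\langle\langle\gamma_\beta\mathcal{W}_{\sigma(2)}\mathcal{W}_{\sigma(3)}\rangle\rangle_1-\frac1{20}\langle\langle\mathcal{W}_{\sigma(1)}\gamma_\alpha\gamma_\beta\rangle\rangle_1\langle\langle\gamma^\alpha\gamma^\beta\mathcal{W}_{\sigma(2)}\mathcal{W}_{\sigma(3)}\rangle\rangle_0+\frac1{60}\langle\langle\mathcal{W}_{\sigma(1)}\mathcal{W}_{\sigma(2)}\gamma_\alpha\{\gamma^\alpha\bullet\mathcal{W}_{\sigma(3)}\}\rangle\rangle_1-\frac1{120}\langle\langle\mathcal{W}_{\sigma(1)}\gamma^\alpha\gamma_\alpha\{\mathcal{W}_{\sigma(2)}\bullet\mathcal{W}_{\sigma(3)}\}\rangle\rangle_1\Big\}$.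 *)

(* Defs.v *)
From HB Require Import structures.
From mathcomp Require Import all_boot all_order all_algebra.
From mathcomp Require Import perm finmap multiset.
From mathcomp Require Import boolp classical_sets functions cardinality fsbigop.

Set Implicit Arguments.
Unset Strict Implicit.
Unset Printing Implicit Defensive.

Import GRing.Theory.

Local Open Scope classical_set_scope.
Local Open Scope mset_scope.
Local Open Scope ring_scope.

(* Formal power series over L in the (possibly infinitely many) variables x_i,
   i : X.  The monomial \prod_i x_i ^ (m i) is encoded by the finite multiset
   m of its indices, so that the product of monomials is the sum `+` of
   multisets; coef f m is the coefficient of that monomial. *)
Record fps (L : Type) (X : choiceType) : Type :=
  FPS { coef : {mset X} -> L }.

(* the (finitely many) factorisations of a monomial *)
Definition msplit (X : choiceType) (m : {mset X}) :
  set ({mset X} * {mset X}) := [set p | p.1 `+` p.2 = m].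

Section FpsZmodule.
Variables (L : zmodType) (X : choiceType).
Implicit Types f g h : fps L X.

Lemma fpsP f g : coef f =1 coef g <-> f = g.
Proof.
split=> [|->//]; case: f g => [f] [g] /= fg; congr FPS; exact/funext.
Qed.

HB.instance Definition _ := gen_eqMixin (fps L X).
HB.instance Definition _ := gen_choiceMixin (fps L X).

Let zero := FPS (fun _ : {mset X} => 0 : L).
Let opp f := FPS (fun m => - coef f m).
Let add f g := FPS (fun m => coef f m + coef g m).

Let addA : associative add.
Proof. by move=> f g h; apply/fpsP => m /=; rewrite addrA. Qed.
Let addC : commutative add.
Proof. by move=> f g; apply/fpsP => m /=; rewrite addrC. Qed.
Let add0 : left_id zero add.
Proof. by move=> f; apply/fpsP => m /=; rewrite add0r. Qed.
Let addN : left_inverse zero opp add.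
Proof. by move=> f; apply/fpsP => m /=; rewrite addNr. Qed.

HB.instance Definition _ := GRing.isZmodule.Build (fps L X) addA addC add0 addN.

Lemma coef0 m : coef (0 : fps L X) m = 0. Proof. by []. Qed.
Lemma coefD f g m : coef (f + g) m = coef f m + coef g m. Proof. by []. Qed.
Lemma coefN f m : coef (- f) m = - coef f m. Proof. by []. Qed.
Lemma coef_sum (I : Type) (r : seq I) (P : pred I) (F : I -> fps L X) m :
  coef (\sum_(i <- r | P i) F i) m = \sum_(i <- r | P i) coef (F i) m.
Proof. by elim/big_rec2: _ => // i x y _ <-. Qed.

End FpsZmodule.

Section MsetSplit.
Variable X : choiceType.
Implicit Types m a b : {mset X}.

Lemma msplit_finite m : finite_set (msplit m).
Proof.
rewrite -(seq_mset_id m); elim: (m : seq X) => [|x s IHs].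
  apply: (@sub_finite_set _ _ [set (mset0, mset0)]); last exact: finite_set1.
  move=> [a b] /=; rewrite /msplit /= => /msetP ab0.
  have e0 c : (a c + b c)%N = 0%N.
    by have := ab0 c; rewrite msetE2 mset_seqE.
  by congr pair; apply/msetP => c; rewrite mset0E; have := e0 c; case: (a c).
rewrite mset_cons; set t := seq_mset s in IHs *.
pose h1 (p : {mset X} * {mset X}) := (x +` p.1, p.2)%mset.
pose h2 (p : {mset X} * {mset X}) := (p.1, x +` p.2)%mset.
apply: (@sub_finite_set _ _ (h1 @` msplit t `|` h2 @` msplit t)%classic); last first.
  by rewrite finite_setU; split; apply: finite_image.
move=> [a b]; rewrite /msplit /= => abt.
have : x \in a `+` b by rewrite abt mset1D1.
rewrite in_msetD => /orP[xa|xb]; [left|right].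
  exists (a `\ x, b); last by rewrite /h1 /= msetB1K.
  by rewrite /= -(msetD1K x t) -abt -{2}(msetB1K xa) -msetDA msetD1K.
exists (a, b `\ x); last by rewrite /h2 /= msetB1K.
by rewrite /= -(msetD1K x t) -abt -{2}(msetB1K xb) msetDCA msetD1K.
Qed.

Definition msub m : set {mset X} := [set a | exists b, a `+` b = m].

Lemma msub_finite m : finite_set (msub m).
Proof.
apply: (@sub_finite_set _ _ (fst @` msplit m)).
  by move=> a [b ab]; exists (a, b).
exact/finite_image/msplit_finite.
Qed.

End MsetSplit.

Section FpsRing.
Variables (L : comNzRingType) (X : choiceType).
Implicit Types f g h : fps L X.

Definition fps_one : fps L X := FPS (fun m => (m == mset0)%:R).
Definition fps_mul f g : fps L X :=
  FPS (fun m => \sum_(p \in msplit m) coef f p.1 * coef g p.2).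

Let coef_mulS f g m u : u `<=` m -> coef (fps_mul f g) u =
  \sum_(a \in msub m) \sum_(b \in msub m)
     (if a `+` b == u then coef f a * coef g b else 0).
Proof.
move=> /msetBDKC; set v := (m `\` u)%mset => uvm.
have sub_um a b : a `+` b = u -> msub m a /\ msub m b.
  move=> abu; rewrite -uvm -abu /msub /=; split; [exists (b `+` v)|exists (a `+` v)].
    by rewrite msetDA.
  by rewrite msetDCA msetDA.
rewrite pair_fsbig; [|exact: msub_finite..].
rewrite /= (_ : msplit u = (msplit u `&` (msub m `*` msub m))%classic); last first.
  by apply/seteqP; split=> [[a b] ab|p []//]; split=> //; exact: sub_um ab.
rewrite fsbig_mkcondl; apply: eq_fsbigr => -[a b] _ /=.
by rewrite (_ : (a, b) \in msplit u = (a `+` b == u)) //; apply/idP/eqP;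
  rewrite inE.
Qed.

Let mulC : commutative fps_mul.
Proof.
move=> f g; apply/fpsP => m; rewrite !(coef_mulS _ _ (msubset_refl m)).
rewrite exchange_fsbig; [|exact: msub_finite..].
by do 2 apply: eq_fsbigr => ? _; rewrite msetDC mulrC.
Qed.

Let mulDl : left_distributive fps_mul +%R.
Proof.
move=> f g h; apply/fpsP => m /=; rewrite -fsbig_split; last exact: msplit_finite.
by apply: eq_fsbigr => p _; rewrite mulrDl.
Qed.

Let mul1 : left_id fps_one fps_mul.
Proof.
move=> f; apply/fpsP => m /=.
rewrite -(fsbig_widen [set (mset0, m)]) ?fsbig_set1 /= ?eqxx ?mul1r //.
  by move=> _ -> /=; rewrite /msplit /= mset0D.
move=> [a b] [/= ab nab]; case: eqP => [a0|]; last by rewrite mul0r.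
by case: nab; rewrite -ab a0 /= mset0D.
Qed.

Let coef_mul3 f g h m : coef (fps_mul (fps_mul f g) h) m =
  \sum_(a \in msub m) \sum_(b \in msub m) \sum_(c \in msub m)
     (if a `+` b `+` c == m then coef f a * coef g b * coef h c else 0).
Proof.
have finS := msub_finite m; rewrite (coef_mulS _ _ (msubset_refl m)).
have sE u : u \in msub m -> u `<=` m.
  rewrite inE => -[b <-]; apply/msubsetP => x; rewrite msetE2; exact: leq_addr.
transitivity (\sum_(u \in msub m) \sum_(c \in msub m) \sum_(a \in msub m)
  \sum_(b \in msub m) (if a `+` b == u then if u `+` c == m then
    coef f a * coef g b * coef h c else 0 else 0)).
  apply: eq_fsbigr => u /sE um; apply: eq_fsbigr => c _.
  rewrite (coef_mulS _ _ um) !fsbig_finite //.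
  under [in RHS]eq_bigr do rewrite fsbig_finite //.
  under [in LHS]eq_bigr do rewrite fsbig_finite //.
  case: eqP => _; last first.
    by rewrite big1 // => a _; rewrite big1 // => b _; case: ifP.
  rewrite big_distrl; apply: eq_bigr => a _; rewrite big_distrl.
  by apply: eq_bigr => b _ /=; case: ifP; rewrite ?mul0r.
under eq_fsbigr => u _.
  under eq_fsbigr do under eq_fsbigr do rewrite fsbig_finite //.
  under eq_fsbigr do rewrite fsbig_finite //.
  rewrite fsbig_finite // exchange_big /=.
  under eq_bigr do rewrite exchange_big /=.
  over.
rewrite /= fsbig_finite // exchange_big /= fsbig_finite //; apply: eq_bigr => a _.
rewrite exchange_big /= fsbig_finite //; apply: eq_bigr => b _.
rewrite exchange_big /= fsbig_finite //; apply: eq_bigr => c _.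
case: ifP => [/eqP abc|nabc].
  rewrite (bigD1_seq (a `+` b)) ?fset_uniq //=; last first.
    by rewrite in_fset_set // inE; exists c.
  rewrite eqxx abc eqxx big1 ?addr0 // => u /negbTE.
  by rewrite eq_sym => ->.
by rewrite big1 // => u _; case: eqP => // <-; rewrite nabc.
Qed.

Let mulA : associative fps_mul.
Proof.
move=> f g h; rewrite [LHS]mulC; apply/fpsP => m.
have finS := msub_finite m; rewrite !coef_mul3.
under eq_fsbigr do rewrite exchange_fsbig //.
rewrite exchange_fsbig //; apply: eq_fsbigr => a _; apply: eq_fsbigr => b _.
apply: eq_fsbigr => c _; rewrite msetDC msetDA.
by case: ifP => // _; rewrite mulrC mulrA.
Qed.

Let one_neq0 : fps_one != 0.
Proof.
apply/eqP => /fpsP /(_ mset0) /eqP.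
by rewrite /= eqxx (negbTE (oner_neq0 L)).
Qed.

HB.instance Definition _ := GRing.Zmodule_isComNzRing.Build (fps L X)
  mulA mulC mul1 mulDl one_neq0.

Lemma coef1 m : coef (1 : fps L X) m = (m == mset0)%:R. Proof. by []. Qed.
Lemma coefM f g m :
  coef (f * g) m = \sum_(p \in msplit m) coef f p.1 * coef g p.2.
Proof. by []. Qed.

End FpsRing.

Section FpsAlgebra.
Variables (K : comNzRingType) (L : comAlgType K) (X : choiceType).
Implicit Types (c : K) (f g : fps L X).

Let scale c f := FPS (fun m => c *: coef f m).

Let scaleA a b f : scale a (scale b f) = scale (a * b) f.
Proof. by apply/fpsP => m /=; rewrite scalerA. Qed.
Let scale1 : left_id 1 scale.
Proof. by move=> f; apply/fpsP => m /=; rewrite scale1r. Qed.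
Let scaleDr : right_distributive scale +%R.
Proof. by move=> c f g; apply/fpsP => m /=; rewrite scalerDr. Qed.
Let scaleDl f : {morph scale^~ f : a b / a + b}.
Proof. by move=> a b; apply/fpsP => m /=; rewrite scalerDl. Qed.

HB.instance Definition _ := GRing.Zmodule_isLmodule.Build K (fps L X)
  scaleA scale1 scaleDr scaleDl.

Lemma coefZ c f m : coef (c *: f) m = c *: coef f m. Proof. by []. Qed.

Let scaleAl c f g : c *: (f * g) = c *: f * g.
Proof.
apply/fpsP => m; rewrite coefZ !coefM !fsbig_finite; try exact: msplit_finite.
by rewrite scaler_sumr; apply: eq_bigr => p _; rewrite scalerAl.
Qed.

HB.instance Definition _ := GRing.Lmodule_isLalgebra.Build K (fps L X) scaleAl.
HB.instance Definition _ := GRing.Lalgebra_isComAlgebra.Build K (fps L X).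

End FpsAlgebra.

Section FpsCalculus.
Variables (L : comNzRingType) (X : choiceType).

Definition fvar (i : X) : fps L X := FPS (fun m => (m == [mset i])%:R).

Definition fderiv (i : X) (f : fps L X) : fps L X :=
  FPS (fun m => coef f (i +` m) *+ (m i).+1).

(* Infinite sums of families are taken coefficientwise.  They are meaningful
   for the families satisfying summable: the \sum_(_ \in _) of fsbigop is 0 when
   the support of the summand is infinite. *)
Definition summable (I : choiceType) (u : I -> fps L X) : Prop :=
  forall m, finite_set [set i | coef (u i) m != 0].

Definition fsum (I : choiceType) (u : I -> fps L X) : fps L X :=
  FPS (fun m => \sum_(i \in [set: I]) coef (u i) m).

End FpsCalculus.

(* The big phase space of a cohomology with basis indexed by 'I_n.+1, i.e. of
   dimension N = n.+1, where ord0 stands for the identity (written with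
   index 1 on paper).  The index (m, a) is that of the coordinate t^a_m and of
   the vector field tau_m(gamma_a) = d/dt^a_m. *)
Definition bps (n : nat) : choiceType := (nat * 'I_n.+1)%type.

Section BigPhaseSpace.
Variables (K : fieldType) (L : comAlgType K) (n : nat).

Notation series := (fps L (bps n)).

(* W : vfield is the formal sum \sum_(i : bps n) W i tau_i. *)
Notation vfield := (bps n -> series).

(* The formal vector fields: families of coefficients that are summable, which
   is what makes W(f) = \sum_i W i * d_i f a well defined formal power series for
   every f.  The finite sums, and the string and dilaton vector fields below,
   are of this kind. *)
Definition is_vfield (W : vfield) : Prop := summable W.

Definition vact (W : vfield) (f : series) : series :=
  fsum (fun i => W i * fderiv i f).

(* corr F [:: W1; ...; Wk] =
     \sum_(i1, ..., ik) W1 i1 * ... * Wk ik * (d^k F / dt_i1 ... dt_ik) *)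
Fixpoint corr (F : series) (Ws : seq vfield) : series :=
  if Ws is W :: Ws' then fsum (fun i => W i * corr (fderiv i F) Ws') else F.

Definition vscale (f : series) (W : vfield) : vfield := fun i => f * W i.

Definition nabla (V W : vfield) : vfield := fun i => vact V (W i).

Definition nabla_tensor (A : vfield -> series) (W V : vfield) : series :=
  vact W (A V) - A (nabla W V).

Definition gam (a : 'I_n.+1) : vfield := fun i => (i == (0%N, a))%:R.

Definition tcoord (m : nat) (a : 'I_n.+1) : series := fvar L ((m, a) : bps n).

Definition ttilde (m : nat) (a : 'I_n.+1) : series :=
  tcoord m a - ((m == 1%N) && (a == ord0))%:R.

(* - \sum ttilde^a_m tau_(m-1)(gamma_a), whose m = 0 terms vanish *)
Definition string_vf : vfield := fun i => - ttilde i.1.+1 i.2.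

Definition dilaton_vf : vfield := fun i => - ttilde i.1 i.2.

Lemma ttilde_coef_supp m (i : bps n) :
  coef (ttilde i.1 i.2) m != 0 -> i \in (1%N, ord0) :: (m : seq (bps n)).
Proof.
case: i => k a; apply: contraR; rewrite in_cons negb_or => /andP[ka im].
rewrite /ttilde coefD coefN (_ : _ && _ = false) ?subr0 /=; last exact/negbTE.
by case: (m =P _) => [mE|//]; rewrite mE mset11 in im.
Qed.

Lemma dilaton_is_vfield : is_vfield dilaton_vf.
Proof.
move=> m; apply: (@sub_finite_set _ _
  [set` (1%N, ord0) :: (m : seq (bps n))]); last exact: finite_seq.
by move=> i /=; rewrite oppr_eq0; exact: ttilde_coef_supp.
Qed.

Lemma string_is_vfield : is_vfield string_vf.
Proof.
move=> m; pose pr (i : bps n) : bps n := (i.1.-1, i.2).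
apply: (@sub_finite_set _ _
  [set` map pr ((1%N, ord0) :: (m : seq (bps n)))]); last exact: finite_seq.
move=> [k a] /=; rewrite oppr_eq0 => /(@ttilde_coef_supp _ (k.+1, a)).
by move=> /(map_f pr).
Qed.

(* \sum f_(m,a) tau_(m+1)(gamma_a) for W = \sum f_(m,a) tau_m(gamma_a) *)
Definition tau_shift (W : vfield) : vfield :=
  fun i => if i.1 is m.+1 then W (m, i.2) else 0.

(* eta is the matrix of the Poincare pairing, F g the genus-g potential. *)
Variables (eta : 'M[K]_n.+1) (F : nat -> series).

Notation "'<<' W , .. , V '>>_' g" := (corr (F g%N) (cons W .. (cons V nil) ..))
  (at level 0, W at level 99, V at level 99, g at level 0).

Definition gup (a : 'I_n.+1) : vfield := \sum_b invmx eta a b *: gam b.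

Definition qprod (U W : vfield) : vfield :=
  \sum_a vscale (<< U, W, gup a >>_0) (gam a).

Notation "U \qp W" := (qprod U W) (at level 40, left associativity).

Definition T (W : vfield) : vfield :=
  tau_shift W - \sum_a vscale (<< W, gup a >>_0) (gam a).

Definition string_equation : Prop := forall g,
  << string_vf >>_g =
    if g == 0%N then (1 / 2) *: \sum_a \sum_b eta a b *: (tcoord 0 a * tcoord 0 b) else 0.

(* The Euler characteristic of V is n.+1, since the odd cohomology vanishes. *)
Definition dilaton_equation : Prop := forall g,
  << dilaton_vf >>_g =
    (2 * g%:R - 2) *: F g + (if g == 1%N then (n.+1%:R / 24)%:A else 0).

Definition genus0_TRR : Prop := forall W V, is_vfield W -> is_vfield V ->
  T W \qp V = 0.

Definition genus1_TRR : Prop := forall W, is_vfield W ->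
  << T W >>_1 = (1 / 24) *: \sum_a << W, gup a, gam a >>_0.

Definition A1 (W : vfield) : series :=
    (7 / 10) *: (\sum_a << gam a >>_1 * << gup a \qp W >>_1)
  + (1 / 10) *: (\sum_a << gam a, gup a \qp W >>_1)
  - (1 / 240) *: (\sum_a << W, gam a \qp gup a >>_1)
  + (13 / 240) *: (\sum_a \sum_b
      << W, gam a, gup a, gup b >>_0 * << gam b >>_1)
  + (1 / 960) *: (\sum_a \sum_b << W, gup a, gam a, gup b, gam b >>_0).

Definition A2 (W V : vfield) : series :=
    (13 / 10) *: (\sum_a \sum_b
      << W, V, gup a, gup b >>_0 * << gam a >>_1 * << gam b >>_1)
  + (4 / 5) *: (\sum_a << W, gup a >>_1 * << gam a \qp V >>_1)
  + (4 / 5) *: (\sum_a << V, gup a >>_1 * << gam a \qp W >>_1)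
  - (4 / 5) *: (\sum_a << W \qp V, gup a >>_1 * << gam a >>_1)
  + (23 / 240) *: (\sum_a \sum_b
      << W, V, gup a, gam a, gup b >>_0 * << gam b >>_1)
  + (1 / 48) *: (\sum_a \sum_b
      << W, gup a, gam a, gup b >>_0 * << gam b, V >>_1)
  + (1 / 48) *: (\sum_a \sum_b
      << V, gup a, gam a, gup b >>_0 * << gam b, W >>_1)
  - (1 / 80) *: (\sum_a << W, V, gup a \qp gam a >>_1)
  + (7 / 30) *: (\sum_a \sum_b
      << W, V, gup a, gup b >>_0 * << gam a, gam b >>_1)
  + (1 / 30) *: (\sum_a << gam a, gup a \qp W, V >>_1)
  + (1 / 30) *: (\sum_a << gam a, gup a \qp V, W >>_1)
  - (1 / 30) *: (\sum_a << W \qp V, gam a, gup a >>_1)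
  + (1 / 576) *: (\sum_a \sum_b
      << W, V, gup a, gam a, gup b, gam b >>_0).

(* the summand of B indexed by a permutation of the three arguments *)
Definition Bsym (X Y Z : vfield) : series :=
  - (1 / 5) *: (\sum_a \sum_b
      << X, Y, gup a, gup b >>_0 * << gam a >>_1 * << gam b, Z >>_1)
  + (2 / 5) *: (\sum_a << X \qp gam a >>_1 * << gup a, Y, Z >>_1)
  - (3 / 5) *: (\sum_a << X, Y \qp gup a >>_1 * << gam a, Z >>_1)
  + (3 / 10) *: (\sum_a << X, gam a >>_1 * << gup a, Y \qp Z >>_1)
  - (1 / 5) *: (\sum_a << gam a >>_1 * << gup a, X, Y \qp Z >>_1)
  - (1 / 80) *: (\sum_a \sum_b
      << X, Y, gup a, gam a, gup b >>_0 * << gam b, Z >>_1)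
  + (1 / 80) *: (\sum_a \sum_b
      << X, gup a, gam a, gup b >>_0 * << gam b, Y, Z >>_1)
  - (1 / 20) *: (\sum_a \sum_b
      << X, gam a, gam b >>_1 * << gup a, gup b, Y, Z >>_0)
  + (1 / 60) *: (\sum_a << X, Y, gam a, gup a \qp Z >>_1)
  - (1 / 120) *: (\sum_a << X, gup a, gam a, Y \qp Z >>_1).

Definition B (W1 W2 W3 : vfield) : series :=
    (1 / 5) *: (\sum_a \sum_b
      << W1, W2, W3, gup a, gup b >>_0 * << gam a >>_1 * << gam b >>_1)
  - (6 / 5) *: (\sum_a \sum_b
      << W1, W2, W3, gup a >>_0 * << gam a, gup b >>_1 * << gam b >>_1)
  + (1 / 120) *: (\sum_a \sum_b
      << W1, W2, W3, gup a, gam a, gup b >>_0 * << gam b >>_1)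
  - (1 / 120) *: (\sum_a << W1, W2, W3, gup a \qp gam a >>_1)
  + (1 / 10) *: (\sum_a \sum_b
      << W1, W2, W3, gup a, gup b >>_0 * << gam a, gam b >>_1)
  - (1 / 20) *: (\sum_a \sum_b
      << W1, W2, W3, gup a >>_0 * << gam a, gup b, gam b >>_1)
  + \sum_(s : 'S_3)
      (let W := tnth [tuple W1; W2; W3] in Bsym (W (s 0)) (W (s 1)) (W (s 2))).

Definition genus1_relation : Prop := forall W1 W2 V,
  is_vfield W1 -> is_vfield W2 -> is_vfield V ->
  B W1 W2 (T V) = A2 (W1 \qp W2) V - nabla_tensor A1 (W1 \qp W2) V.

Definition genus2_TRR_I : Prop := forall W, is_vfield W ->
  << T (T W) >>_2 = A1 W.

Definition genus2_TRR_II : Prop := forall W V, is_vfield W -> is_vfield V ->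
  << T W, T V >>_2 - 3 *: << T (W \qp V) >>_2 = A2 W V.

Definition genus2_TRR_III : Prop := forall W1 W2 W3,
  is_vfield W1 -> is_vfield W2 -> is_vfield W3 ->
    2 *: << W1 \qp W2 \qp W3 >>_2
  - 2 *: (\sum_a << W1, W2, W3, gup a >>_0 * << T (gam a) >>_2)
  + (<< W1, T (W2 \qp W3) >>_2 - << T W1, W2 \qp W3 >>_2)
  + (<< W2, T (W1 \qp W3) >>_2 - << T W2, W1 \qp W3 >>_2)
  + (<< W3, T (W1 \qp W2) >>_2 - << T W3, W1 \qp W2 >>_2)
  = B W1 W2 W3.

End BigPhaseSpace.

(* Main.v *)
From HB Require Import structures.
From mathcomp Require Import all_boot all_order all_algebra.
From mathcomp Require Import finmap multiset.
From mathcomp Require Import boolp classical_sets functions cardinality fsbigop.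
From mathcomp Require Import reals complex ring.
Require Import Defs.

Set Implicit Arguments.
Unset Strict Implicit.
Unset Printing Implicit Defensive.

Import GRing.Theory Num.Theory.

Local Open Scope mset_scope.
Local Open Scope ring_scope.

(** The recursion operator T kills the quantum product.  Hence, in the third
    recursion relation of genus two with W3 = T V, most terms vanish: the
    four-point function << W1, W2, T V, gup a >>_0 collapses to a component of
    W1 \qp W2 \qp V, and differentiating the first recursion relation along
    U = W1 \qp W2 turns << U, T (T V) >>_2 into the covariant derivative of A1
    plus << T (U \qp V) >>_2 (lemma corr2_T2).  Together with the genus-one
    relation this is the second recursion relation for the pair (U, V)
    (lemma TRR_II_qprod).

    Every field decomposes as W = S \qp W + T (tau_down W), where S is the string
    field; this follows from the string equation (lemma string_decomposition).
    The second relation is linear and symmetric in its two arguments, so it only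
    remains to prove it for a pair (T W, T V).  There the products vanish, and
    corr2_T2 identifies the left-hand side << T (T W), T (T V) >>_2 with the
    covariant derivative of A1 at W along T (T V).  So the theorem comes down to

      A2 (T W) (T V) = nabla_tensor A1 (T (T V)) W          (lemma A2_TT),

    which involves genus zero and genus one only.  The recursion relations there,
    differentiated as often as needed, remove the descendants one at a time and
    express both sides through << V \qp W \qp Delta >>_1, where Delta is the sum
    of the gup a \qp gam a, and four-point functions of genus zero contracted
    twice with eta.  The coefficients of the former agree; the latter agree modulo
    five linear relations, which are traces of the derivative of the associativity
    of the product (lemmas wdvv_trace and rational_identity).

    Vector fields being infinite combinations of the partial derivatives, all this
    rests on a calculus of summable families: correlators are symmetric
    (corr_swap), linear over the series in each entry (slin_corr), and are
    differentiated by the Leibniz rule (vact_corr). *)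

(** * Summable families of power series *)

Section Truncation.
Variables (L : comNzRingType) (X : choiceType).
Implicit Types (f g : fps L X) (m a : {mset X}).

(** Congruence modulo the monomials that do not divide m.  It is compatible with
    products, and modulo it an infinite sum is a finite one. *)
Definition agree m f g : Prop := forall a, msub m a -> coef f a = coef g a.

Lemma msub_refl m : msub m m.
Proof. by exists mset0%mset; rewrite msetD0. Qed.

Lemma msub_trans m a b : msub m a -> msub a b -> msub m b.
Proof. by move=> [c <-] [d <-]; exists (d `+` c)%mset; rewrite msetDA. Qed.

Lemma fps_eqP f g : (forall m, agree m f g) -> f = g.
Proof. by move=> fg; apply/fpsP => m; apply: fg; exact: msub_refl. Qed.

Lemma agree_trans m g f h : agree m f g -> agree m g h -> agree m f h.
Proof. by move=> fg gh a am; rewrite fg // gh. Qed.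

Lemma agree_sym m f g : agree m f g -> agree m g f.
Proof. by move=> fg a am; rewrite fg. Qed.

Lemma agree_mul m f g f' g' :
  agree m f g -> agree m f' g' -> agree m (f * f') (g * g').
Proof.
move=> fg fg' a am; rewrite !coefM; apply: eq_fsbigr => -[b c].
rewrite inE => /= bc; rewrite fg ?fg' //; apply: msub_trans am _.
  by exists b; rewrite msetDC.
by exists c.
Qed.

Lemma agree_sum (I : Type) (r : seq I) (u v : I -> fps L X) m :
  (forall i, agree m (u i) (v i)) ->
  agree m (\sum_(i <- r) u i) (\sum_(i <- r) v i).
Proof. by move=> uv a am; rewrite !coef_sum; apply: eq_bigr => i _; apply: uv. Qed.

Lemma agree_mul0 m f g : agree m f 0 -> agree m (f * g) 0.
Proof. by move=> f0; rewrite -(mul0r g); apply: agree_mul. Qed.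

Lemma summableP (I : choiceType) (u : I -> fps L X) :
  summable u <-> (forall m, exists A : {fset I},
                    forall i, i \notin A -> agree m (u i) 0).
Proof.
split=> [su m|su m]; last first.
  have [A AP] := su m; apply: (@sub_finite_set _ _ [set` A]%classic) => //.
  move=> i /=; apply: contraR => /AP /(_ _ (msub_refl m)) ->.
  by rewrite coef0.
have := bigcup_finite (msub_finite m) (fun a _ => su a).
move=> /finite_fsetP[A AE]; exists A => i iA a am; rewrite coef0.
apply/eqP; apply: contraNT iA => ua.
by have : [set` A]%classic i by rewrite -AE; exists a.
Qed.

Lemma fsum_agree (I : choiceType) (u : I -> fps L X) (A : {fset I}) m :
  (forall i, i \notin A -> agree m (u i) 0) ->
  agree m (fsum u) (\sum_(i <- A) u i).
Proof.
move=> uA a am; rewrite /= coef_sum; apply: fsbigTE => i iA.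
by rewrite uA // coef0.
Qed.

Lemma eq_fsum (I : choiceType) (u v : I -> fps L X) :
  u =1 v -> fsum u = fsum v.
Proof. by move=> /funext ->. Qed.

Lemma fsum0 (I : choiceType) (u : I -> fps L X) :
  (forall i, u i = 0) -> fsum u = 0.
Proof. by move=> u0; apply/fpsP => m /=; rewrite fsbig1 // => i _; rewrite u0. Qed.

Lemma summable_mulr (I : choiceType) (u c : I -> fps L X) :
  summable u -> summable (fun i => u i * c i).
Proof.
move=> /summableP su; apply/summableP => m; have [A AP] := su m.
by exists A => i iA; apply/agree_mul0/AP.
Qed.

Lemma summableD (I : choiceType) (u v : I -> fps L X) :
  summable u -> summable v -> summable (fun i => u i + v i).
Proof.
move=> /summableP su /summableP sv; apply/summableP => m.
have [[A AP] [B BP]] := (su m, sv m).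
exists (A `|` B)%fset => i; rewrite in_fsetU negb_or => /andP[iA iB] a am.
by rewrite coefD AP // BP // coef0 addr0.
Qed.

Lemma fsumD (I : choiceType) (u v : I -> fps L X) :
  summable u -> summable v -> fsum (fun i => u i + v i) = fsum u + fsum v.
Proof.
move=> /summableP su /summableP sv; apply: fps_eqP => m.
have [[A AP] [B BP]] := (su m, sv m).
pose C := (A `|` B)%fset.
have CA i : i \notin C -> agree m (u i) 0.
  by rewrite in_fsetU negb_or => /andP[/AP].
have CB i : i \notin C -> agree m (v i) 0.
  by rewrite in_fsetU negb_or => /andP[_ /BP].
apply: (agree_trans (g := \sum_(i <- C) (u i + v i))).
  apply: fsum_agree => i iC a am.
  by rewrite coefD (CA _ iC) // (CB _ iC) // coef0 addr0.
by rewrite big_split => a am; rewrite !coefD !(fsum_agree CA, fsum_agree CB).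
Qed.

Lemma mulr_fsum (I : choiceType) f (u : I -> fps L X) :
  summable u -> f * fsum u = fsum (fun i => f * u i).
Proof.
move=> /summableP su; apply: fps_eqP => m; have [A AP] := su m.
apply: (agree_trans (g := f * \sum_(i <- A) u i)).
  by apply: agree_mul => //; apply: fsum_agree.
rewrite mulr_sumr; apply/agree_sym/fsum_agree => i iA.
by rewrite mulrC; apply/agree_mul0/AP.
Qed.

Lemma fsum_big_summable (I : choiceType) (J : Type) (r : seq J) (u : J -> I -> fps L X) :
  (forall j, summable (u j)) ->
  fsum (fun i => \sum_(j <- r) u j i) = \sum_(j <- r) fsum (u j) /\
  summable (fun i => \sum_(j <- r) u j i).
Proof.
move=> su; elim: r => [|j r [IH1 IH2]].
  split; last by apply/summableP => m; exists fset0 => i _; rewrite big_nil.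
  rewrite big_nil; apply/fpsP => m /=; rewrite fsbig1 // => i _.
  by rewrite big_nil.
have E : (fun i => \sum_(k <- j :: r) u k i) =
         (fun i => u j i + \sum_(k <- r) u k i).
  by apply/funext => i; rewrite big_cons.
by rewrite E big_cons fsumD // IH1; split=> //; exact: summableD.
Qed.

Lemma fsum_big (I : choiceType) (J : Type) (r : seq J) (u : J -> I -> fps L X) :
  (forall j, summable (u j)) ->
  fsum (fun i => \sum_(j <- r) u j i) = \sum_(j <- r) fsum (u j).
Proof. by case/(fsum_big_summable r). Qed.

(** Below a given monomial only finitely many outer indices contribute, so that
    one finite set of inner indices truncates all the inner families at once,
    and the exchange becomes that of two finite sums. *)
Lemma fsum_exchange (I J : choiceType) (u : I -> fps L X)
    (v : I -> J -> fps L X) :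
  summable u -> (forall i, summable (v i)) ->
  summable (fun j => fsum (fun i => u i * v i j)) /\
  fsum (fun i => u i * fsum (v i)) = fsum (fun j => fsum (fun i => u i * v i j)).
Proof.
move=> /summableP su sv.
have trunc m : exists (A : {fset I}) (B : {fset J}),
    (forall i, i \notin A -> agree m (u i) 0) /\
    (forall i j, i \in A -> j \notin B -> agree m (v i j) 0).
  have [A AP] := su m; exists A.
  have [|h hP] := @choice I {fset J}
    (fun i B => forall j, j \notin B -> agree m (v i j) 0).
    by move=> i; move/summableP: (sv i) => /(_ m).
  exists (\big[fsetU/fset0]_(i <- A) h i)%fset; split=> // i j iA.
  move=> jB; apply: hP; apply: contraNN jB => jh.
  by rewrite (bigD1_seq i) ?fset_uniq //= in_fsetU jh.
have vanish m (A : {fset I}) (B : {fset J}) :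
    (forall i, i \notin A -> agree m (u i) 0) ->
    (forall i j, i \in A -> j \notin B -> agree m (v i j) 0) ->
    forall j, agree m (fsum (fun i => u i * v i j)) (\sum_(i <- A) u i * v i j)
      /\ (j \notin B -> agree m (fsum (fun i => u i * v i j)) 0).
  move=> AP BP j.
  have E : agree m (fsum (fun i => u i * v i j)) (\sum_(i <- A) u i * v i j).
    by apply: fsum_agree => i iA; apply/agree_mul0/AP.
  split=> // jB; apply: (agree_trans E) => a am.
  rewrite coef_sum coef0 big_seq big1 // => i iA.
  by rewrite mulrC (agree_mul0 (u i) (BP _ _ iA jB) am) coef0.
split.
  apply/summableP => m; have [A [B [AP BP]]] := trunc m.
  by exists B => j; case: (vanish m A B AP BP j).
apply: fps_eqP => m; have [A [B [AP BP]]] := trunc m.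
apply: (agree_trans (g := \sum_(i <- A) u i * \sum_(j <- B) v i j)).
  apply: (agree_trans (g := \sum_(i <- A) u i * fsum (v i))).
    by apply: fsum_agree => i iA; apply/agree_mul0/AP.
  move=> a am; rewrite !coef_sum big_seq [in RHS]big_seq.
  apply: eq_bigr => i iA; apply: agree_mul am => //.
  by apply: fsum_agree => j; apply: BP.
apply/agree_sym; apply: (agree_trans (g := \sum_(j <- B) fsum (fun i => u i * v i j))).
  by apply: fsum_agree => j; case: (vanish m A B AP BP j).
apply: (agree_trans (g := \sum_(j <- B) \sum_(i <- A) u i * v i j)).
  by apply: agree_sum => j; case: (vanish m A B AP BP j).
rewrite exchange_big /= => a am; congr coef.
by apply: eq_bigr => i _; rewrite mulr_sumr.
Qed.

End Truncation.

(** * Partial derivatives *)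

Section Derivation.
Variables (L : comNzRingType) (X : choiceType).
Implicit Types (f g : fps L X) (m : {mset X}) (i j : X).

Lemma fderiv_is_zmod_morphism i : zmod_morphism (@fderiv L X i).
Proof. by move=> f g; apply/fpsP => m /=; rewrite mulrnBl. Qed.
HB.instance Definition _ i :=
  GRing.isZmodMorphism.Build (fps L X) (fps L X) (@fderiv L X i)
    (fderiv_is_zmod_morphism i).

Lemma fderivC i j f : fderiv i (fderiv j f) = fderiv j (fderiv i f).
Proof.
apply/fpsP => m /=; rewrite -!mulrnA msetDCA; congr (_ *+ _).
rewrite !mset1DE eq_sym; case: eqVneq => [->|nij] //=.
by rewrite !add0n mulnC.
Qed.

(** Read off at the monomial i +` m, the Leibniz rule says that the multiplicity
    of i in a product of monomials is the sum of its multiplicities in the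
    factors. *)
Lemma fderivM i f g : fderiv i (f * g) = fderiv i f * g + f * fderiv i g.
Proof.
(* the share of the derivative carried by the first factor *)
pose half f g m := \sum_(p \in msplit (i +` m)%mset)
  (coef f p.1 * coef g p.2) *+ p.1 i.
have halfE f' g' m : half f' g' m = coef (fderiv i f' * g') m.
  rewrite coefM /half /=.
  pose h (p : {mset X} * {mset X}) := ((i +` p.1)%mset, p.2).
  have hinj : {in msplit m &, injective h}.
    move=> [a b] [a' b'] _ _ [/msetP ab ->]; congr pair.
    by apply/msetP => x; have := ab x; rewrite !mset1DE => /addnI.
  rewrite (_ : \sum_(p \in msplit m) _ = \sum_(p \in msplit m)
    (coef f' (h p).1 * coef g' (h p).2) *+ (h p).1 i); last first.
    by apply: eq_fsbigr => p _ /=; rewrite mset1DE eqxx add1n mulrnAl.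
  rewrite -(fsbig_image (msplit m) h (fun p => (coef f' p.1 * coef g' p.2) *+ p.1 i)) //.
  symmetry; apply: fsbig_widen.
    by move=> _ [[a b] /= ab <-]; rewrite /msplit /= -msetDA ab.
  move=> [a0 b0] /=; move: (a0 : {mset X}) (b0 : {mset X}) => {a0 b0} a b [/= ab nh].
  have [ia|] := boolP (i \in a); last by move/mset_eq0P => ->; rewrite mulr0n.
  case: nh; exists (a `\ i, b)%mset; last by rewrite /h /= msetB1K.
  rewrite /msplit /=; have := ab; rewrite /msplit /= -{1}(msetB1K ia) -msetDA.
  by move=> /(congr1 (fun s => (s `\ i)%mset)); rewrite !msetD1K.
apply/fpsP => m; rewrite coefD -halfE [f * fderiv i g]mulrC -halfE.
have swap : set_bij (msplit (i +` m)%mset) (msplit (i +` m)%mset)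
    (fun p : {mset X} * {mset X} => (p.2, p.1)).
  split.
  - by move=> [a b]; rewrite /msplit /= msetDC.
  - by move=> [a b] [a' b'] _ _ /= [-> ->].
  - by move=> [a b] ab; exists (b, a) => //; move: ab; rewrite /msplit /= msetDC.
have -> : half g f m = \sum_(p \in msplit (i +` m)%mset)
    (coef f p.1 * coef g p.2) *+ p.2 i.
  rewrite /half (reindex_fsbig _ _ _ _ swap); apply: eq_fsbigr => p _ /=.
  by rewrite mulrC.
rewrite /half -fsbig_split /=; last exact: msplit_finite.
rewrite /= !fsbig_finite; try exact: msplit_finite.
rewrite -sumrMnl !big_seq; apply: eq_bigr => p.
rewrite in_fset_set; last exact: msplit_finite.
rewrite inE /msplit /= => pm; rewrite -mulrnDr; congr (_ *+ _).
have := congr1 (fun s : {mset X} => s i) pm.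
by rewrite mset1DE msetE2 eqxx add1n.
Qed.

Lemma fderiv_fsum i (I : choiceType) (u : I -> fps L X) :
  summable u -> fderiv i (fsum u) = fsum (fun k => fderiv i (u k)).
Proof.
move=> /summableP su; apply/fpsP => m; have [A AP] := su (i +` m)%mset.
have uA k : k \notin A -> coef (u k) (i +` m)%mset = 0.
  by move=> kA; rewrite AP //; exact: msub_refl.
rewrite /= (fsbigTE A _ uA) (fsbigTE A); first by rewrite sumrMnl.
by move=> k kA; rewrite uA // mul0rn.
Qed.

Lemma summable_fderiv i (I : choiceType) (u : I -> fps L X) :
  summable u -> summable (fun k => fderiv i (u k)).
Proof.
move=> su m; apply: sub_finite_set (su (i +` m)%mset) => k /=.
by apply: contraNN => /eqP ->; rewrite mul0rn.
Qed.

End Derivation.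

(** * Vector fields on the big phase space *)

(** A sealed copy of corr.  Correlators are matched up to unification all along,
    and unfolding these iterated infinite sums makes a failing match diverge.
    The products and the recursion operator below are sealed likewise. *)
HB.lock Definition cor (K : fieldType) (L : comAlgType K) (n : nat)
  (F : fps L (bps n)) (Ws : seq (bps n -> fps L (bps n))) : fps L (bps n) :=
  corr F Ws.
Arguments cor {K L n} F Ws.

Section Fields.
Variables (K : fieldType) (L : comAlgType K) (n : nat).
Notation series := (fps L (bps n)).
Notation vfield := (bps n -> series).
Implicit Types (U V W : vfield) (f g : series) (F : series) (Ws : seq vfield).

Lemma vfield_add V W : is_vfield V -> is_vfield W -> is_vfield (V + W).
Proof. exact: summableD. Qed.

Lemma vfield_opp W : is_vfield W -> is_vfield (- W).
Proof.
move=> vW; rewrite (_ : - W = fun i => W i * (-1)); first exact: summable_mulr.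
by apply/funext => i; rewrite mulrN1.
Qed.

Lemma vfield_vscale f W : is_vfield W -> is_vfield (vscale f W).
Proof.
move=> vW; rewrite (_ : vscale f W = fun i => W i * f); first exact: summable_mulr.
by apply/funext => i; rewrite mulrC.
Qed.

Lemma vfield_scale (c : K) W : is_vfield W -> is_vfield (c *: W).
Proof.
move=> vW; rewrite (_ : c *: W = vscale c%:A W); first exact: vfield_vscale.
by apply/funext => i; rewrite /vscale -scalerAl mul1r.
Qed.

Lemma vfield_sum (I : Type) (r : seq I) (Ws : I -> vfield) :
  (forall i, is_vfield (Ws i)) -> is_vfield (\sum_(i <- r) Ws i).
Proof.
move=> vW; rewrite fct_sumE.
by case: (@fsum_big_summable _ _ _ _ r (fun j i => Ws j i) vW).
Qed.

Lemma vfield_gam a : is_vfield (gam L a : vfield).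
Proof.
apply/summableP => m; exists [fset ((0%N, a) : bps n)]%fset => i.
by rewrite in_fset1 /gam => /negbTE -> b _.
Qed.

Lemma vfield_gup (eta : 'M[K]_n.+1) a : is_vfield (gup L eta a : vfield).
Proof. by apply: vfield_sum => b; apply/vfield_scale/vfield_gam. Qed.

Lemma vfield_nabla V W : is_vfield V -> is_vfield W -> is_vfield (nabla V W).
Proof.
move=> vV vW.
have [] := fsum_exchange vV (v := fun j i => fderiv j (W i)) => // j.
exact: summable_fderiv.
Qed.

(** * Calculus of correlators *)

Lemma corr_nil F : cor F [::] = F.
Proof. by rewrite cor.unlock. Qed.

Lemma corr_cons F W Ws :
  cor F (W :: Ws) = fsum (fun i => W i * cor (fderiv i F) Ws).
Proof. by rewrite cor.unlock. Qed.

Lemma eq_corr_cons F W Ws Vs :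
  (forall i, cor (fderiv i F) Ws = cor (fderiv i F) Vs) ->
  cor F (W :: Ws) = cor F (W :: Vs).
Proof. by move=> E; rewrite !corr_cons; apply: eq_fsum => i; rewrite E. Qed.

Lemma corrD F V W Ws : is_vfield V -> is_vfield W ->
  cor F (V + W :: Ws) = cor F (V :: Ws) + cor F (W :: Ws).
Proof.
move=> vV vW; rewrite !corr_cons -fsumD; [|exact: summable_mulr..].
by apply: eq_fsum => i; rewrite -mulrDl.
Qed.

Lemma corr_vscale F f W Ws : is_vfield W ->
  cor F (vscale f W :: Ws) = f * cor F (W :: Ws).
Proof.
move=> vW; rewrite !corr_cons mulr_fsum; last exact: summable_mulr.
by apply: eq_fsum => i; rewrite mulrA.
Qed.

Lemma corr_sum F (I : Type) (r : seq I) (Vs : I -> vfield) Ws :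
  (forall i, is_vfield (Vs i)) ->
  cor F (\sum_(i <- r) Vs i :: Ws) = \sum_(i <- r) cor F (Vs i :: Ws).
Proof.
move=> vV; rewrite corr_cons.
under [RHS]eq_bigr do rewrite corr_cons.
rewrite -fsum_big => [|j]; last exact/summable_mulr/vV.
by apply: eq_fsum => i; rewrite fct_sumE mulr_suml.
Qed.

Lemma scale_vscale (c : K) W : c *: W = vscale c%:A W.
Proof. by apply/funext => i; rewrite /vscale -scalerAl mul1r. Qed.

Lemma opp_vscale W : - W = vscale (-1) W.
Proof. by apply/funext => i; rewrite /vscale mulN1r. Qed.

Lemma corrN F W Ws : is_vfield W ->
  cor F (- W :: Ws) = - cor F (W :: Ws).
Proof. by move=> vW; rewrite opp_vscale corr_vscale // mulN1r. Qed.

Lemma corr_gam F a Ws :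
  cor F (gam L a :: Ws) = cor (fderiv ((0%N, a) : bps n) F) Ws.
Proof.
rewrite corr_cons; apply: fps_eqP => m.
apply: (agree_trans (g := \sum_(i <- [fset ((0%N, a) : bps n)]%fset)
   gam L a i * cor (fderiv i F) Ws)).
  apply: fsum_agree => i; rewrite in_fset1 /gam => /negbTE -> b _.
  by rewrite mul0r.
by rewrite big_seq_fset1 /gam eqxx mul1r.
Qed.

Lemma vact_fsum U (I : choiceType) (u : I -> series) :
  is_vfield U -> summable u ->
  vact U (fsum u) = fsum (fun i => vact U (u i)).
Proof.
move=> vU su; have [_ <-] := fsum_exchange vU (fun i => summable_fderiv i su).
by apply: eq_fsum => i; rewrite fderiv_fsum.
Qed.

Lemma vactD U f g : is_vfield U -> vact U (f + g) = vact U f + vact U g.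
Proof.
move=> vU; rewrite /vact -fsumD; [|exact: summable_mulr..].
by apply: eq_fsum => i; rewrite raddfD mulrDr.
Qed.

Lemma vactM U f g : is_vfield U -> vact U (f * g) = vact U f * g + f * vact U g.
Proof.
move=> vU; rewrite [vact U f * g]mulrC /vact !mulr_fsum; [|exact: summable_mulr..].
rewrite -fsumD; last 2 first.
- have -> : (fun i => g * (U i * fderiv i f)) = fun i => U i * (g * fderiv i f).
    by apply/funext => i; rewrite mulrCA.
  exact: summable_mulr.
- have -> : (fun i => f * (U i * fderiv i g)) = fun i => U i * (f * fderiv i g).
    by apply/funext => i; rewrite mulrCA.
  exact: summable_mulr.
by apply: eq_fsum => i; rewrite fderivM; ring.
Qed.

(** Partial derivatives commute. *)
Lemma corr_swap F V W Ws : is_vfield V -> is_vfield W ->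
  cor F (V :: W :: Ws) = cor F (W :: V :: Ws).
Proof.
move=> vV vW.
have E A C : cor F (A :: C :: Ws) =
    fsum (fun i => A i * fsum (fun j => C j * cor (fderiv j (fderiv i F)) Ws)).
  by rewrite corr_cons; apply: eq_fsum => i; rewrite corr_cons.
rewrite !E; have [_ ->] := fsum_exchange vV
  (v := fun i j => W j * cor (fderiv j (fderiv i F)) Ws)
  (fun i => summable_mulr _ vW).
apply: eq_fsum => j; rewrite [RHS]mulr_fsum; last exact: summable_mulr.
by apply: eq_fsum => i; rewrite mulrCA fderivC.
Qed.

Fixpoint all_vfield Ws : Prop :=
  if Ws is W :: Ws' then is_vfield W /\ all_vfield Ws' else True.

Lemma corr_move F Ws W Vs : is_vfield W -> all_vfield Ws ->
  cor F (Ws ++ W :: Vs) = cor F (W :: Ws ++ Vs).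
Proof.
move=> vW; elim: Ws F => [|U Ws IH] F //= [vU vWs].
rewrite [RHS]corr_swap //; apply: eq_corr_cons => i; exact: IH.
Qed.

Lemma corr_bring F W Us Ws Vs : is_vfield W -> all_vfield Ws ->
  (forall G, cor G Us = cor G (Ws ++ Vs)) ->
  cor F (W :: Us) = cor F (Ws ++ W :: Vs).
Proof. by move=> vW vWs E; rewrite corr_move //; apply: eq_corr_cons. Qed.

(** The lists obtained from Ws by differentiating one entry along U. *)
Fixpoint nabla_entries U Ws : seq (seq vfield) :=
  if Ws is W :: Ws' then (nabla U W :: Ws') :: map (cons W) (nabla_entries U Ws')
  else [::].

(** The Leibniz rule: U differentiates either the potential, which inserts U in
    the correlator, or one of the coefficients of the entries. *)
Lemma vact_corr U F Ws : is_vfield U -> all_vfield Ws ->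
  vact U (cor F Ws) =
    cor F (U :: Ws) + \sum_(Vs <- nabla_entries U Ws) cor F Vs.
Proof.
move=> vU; elim: Ws F => [|W Ws IH] F => [_|[vW vWs]].
  rewrite /= big_nil addr0 corr_nil corr_cons /vact.
  by apply: eq_fsum => i; rewrite corr_nil.
rewrite /= big_cons big_map [cor F (W :: Ws)]corr_cons.
rewrite vact_fsum //; last exact: summable_mulr.
have -> : (fun i => vact U (W i * cor (fderiv i F) Ws)) = fun i =>
    (nabla U W i * cor (fderiv i F) Ws + W i * cor (fderiv i F) (U :: Ws)) +
     \sum_(Vs <- nabla_entries U Ws) W i * cor (fderiv i F) Vs.
  by apply/funext => i; rewrite vactM // IH // mulrDr addrA mulr_sumr.
have s1 : summable (fun i => nabla U W i * cor (fderiv i F) Ws).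
  exact/summable_mulr/vfield_nabla.
have s2 : summable (fun i => W i * cor (fderiv i F) (U :: Ws)).
  exact: summable_mulr.
have s3 Vs : summable (fun i => W i * cor (fderiv i F) Vs).
  exact: summable_mulr.
have [s4 s5] := fsum_big_summable (nabla_entries U Ws) s3.
rewrite (corr_swap _ _ vU vW) !(corr_cons F).
under [X in _ = _ + (_ + X)]eq_bigr do rewrite corr_cons.
rewrite fsumD //; last exact: summableD.
by rewrite fsumD // s4 [X in X + _]addrC -addrA.
Qed.

End Fields.

(* Equality of two correlators with permuted entries: each round brings the head
   of the left list to the front of the right one. *)
Ltac corr_perm :=
  intros;
  match goal with
  | |- cor _ nil = cor _ nil => reflexivity
  | |- cor _ (?W :: _) = cor _ ?l2 =>
    let rec find pre l :=
      lazymatch l with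
      | W :: ?rest => refine (@corr_bring _ _ _ _ W _ pre rest _ _ _)
      | ?x :: ?rest =>
        let pre' := constr:(pre ++ [:: x]) in
        let pre'' := eval cbv [cat] in pre' in find pre'' rest
      end in
    let T := type of W in
    find constr:(@nil T) l2; [by [] | by [] | cbv [cat]; corr_perm]
  end.

(** * Quantum product and recursion operator *)

HB.lock Definition qmul (K : fieldType) (L : comAlgType K) (n : nat)
  (eta : 'M[K]_n.+1) (F : nat -> fps L (bps n)) (U W : bps n -> fps L (bps n)) :
  bps n -> fps L (bps n) :=
  \sum_a vscale (cor (F 0) [:: U; W; gup L eta a]) (gam L a).
Arguments qmul {K L n} eta F U W.

(** The derivative of the quantum product; its components are four-point
    functions. *)
HB.lock Definition qmul3 (K : fieldType) (L : comAlgType K) (n : nat)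
  (eta : 'M[K]_n.+1) (F : nat -> fps L (bps n))
  (X Y Z : bps n -> fps L (bps n)) : bps n -> fps L (bps n) :=
  \sum_a vscale (cor (F 0) [:: X; Y; Z; gup L eta a]) (gam L a).
Arguments qmul3 {K L n} eta F X Y Z.

HB.lock Definition trr_op (K : fieldType) (L : comAlgType K) (n : nat)
  (eta : 'M[K]_n.+1) (F : nat -> fps L (bps n)) (W : bps n -> fps L (bps n)) :
  bps n -> fps L (bps n) :=
  tau_shift W - \sum_a vscale (cor (F 0) [:: W; gup L eta a]) (gam L a).
Arguments trr_op {K L n} eta F W.

Section ProductFields.
Variables (K : fieldType) (L : comAlgType K) (n : nat).
Variables (eta : 'M[K]_n.+1) (F : nat -> fps L (bps n)).
Notation series := (fps L (bps n)).
Notation vfield := (bps n -> series).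
Notation "'<<' W , .. , V '>>_' g" := (cor (F g%N) (cons W .. (cons V nil) ..))
  (at level 0, W at level 99, V at level 99, g at level 0).
Notation "U \qp W" := (qmul eta F U W) (at level 40, left associativity).
Notation gup := (gup L eta).
Notation gam := (gam L).
Notation T := (trr_op eta F).
Implicit Types (U V W X Y Z : vfield) (f g : series) (Ws Vs Cs : seq vfield).

Lemma vfield_comb (h : 'I_n.+1 -> series) :
  is_vfield (\sum_a vscale (h a) (gam a) : vfield).
Proof. by apply: vfield_sum => a; apply/vfield_vscale/vfield_gam. Qed.

Lemma vfield_qprod U W : is_vfield (U \qp W).
Proof. by rewrite qmul.unlock; apply: vfield_comb. Qed.

Lemma vfield_qprod3 X Y Z : is_vfield (qmul3 eta F X Y Z).
Proof. by rewrite qmul3.unlock; apply: vfield_comb. Qed.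

Lemma vfield_tau_shift W : is_vfield W -> is_vfield (tau_shift W).
Proof.
move=> /summableP vW; apply/summableP => m; have [A AP] := vW m.
exists [fset ((i.1.+1, i.2) : bps n) | i in A]%fset => -[[|k] a] iA //=.
apply: AP; apply: contraNN iA => iA.
by apply/imfsetP; exists (k, a).
Qed.

Lemma vfield_T W : is_vfield W -> is_vfield (T W).
Proof.
move=> vW; rewrite trr_op.unlock.
apply: vfield_add; first exact: vfield_tau_shift.
exact/vfield_opp/vfield_comb.
Qed.

End ProductFields.

(* The closure properties are tried by the head symbol of the field only, so that
   no definition is unfolded. *)
Ltac vfield_step :=
  match goal with
  | H : is_vfield ?W |- is_vfield ?W => exact H
  | H : forall a, is_vfield (?V a) |- is_vfield (?V _) => exact: H
  | |- is_vfield (gam _ _) => apply: vfield_gam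
  | |- is_vfield (gup _ _ _) => apply: vfield_gup
  | |- is_vfield (qmul _ _ _ _) => apply: vfield_qprod
  | |- is_vfield (qmul3 _ _ _ _ _) => apply: vfield_qprod3
  | |- is_vfield (trr_op _ _ _) => apply: vfield_T
  | |- is_vfield (nabla _ _) => apply: vfield_nabla
  | |- is_vfield (vscale _ _) => apply: vfield_vscale
  | |- is_vfield (GRing.add _ _) => apply: vfield_add
  | |- is_vfield (GRing.opp _) => apply: vfield_opp
  | |- is_vfield (GRing.scale _ _) => apply: vfield_scale
  | |- is_vfield (bigop _ _ _) => apply: vfield_sum => ?
  | |- all_vfield (_ :: _) => split
  | |- all_vfield nil => exact I
  end.
#[global] Hint Extern 0 (is_vfield _) => solve [repeat vfield_step] : core.
#[global] Hint Extern 0 (all_vfield _) => solve [repeat vfield_step] : core.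

Section Products.
Variables (K : fieldType) (L : comAlgType K) (n : nat).
Variables (eta : 'M[K]_n.+1) (F : nat -> fps L (bps n)).
Notation series := (fps L (bps n)).
Notation vfield := (bps n -> series).
Notation "'<<' W , .. , V '>>_' g" := (cor (F g%N) (cons W .. (cons V nil) ..))
  (at level 0, W at level 99, V at level 99, g at level 0).
Notation "U \qp W" := (qmul eta F U W) (at level 40, left associativity).
Notation gup := (gup L eta).
Notation gam := (gam L).
Notation T := (trr_op eta F).
Notation qprod3 := (qmul3 eta F).
Implicit Types (U V W X Y Z : vfield) (f g : series) (Ws Vs Cs : seq vfield).

(** * Linearity over the power series ring *)

Lemma vfield_zero : is_vfield (0 : vfield).
Proof. by apply/summableP => m; exists fset0 => i _ a _. Qed.

(** Linearity over the ring of series, asked only of the summable families: the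
    infinite sums have no meaning on the others. *)
Definition slin (f : vfield -> series) : Prop :=
  (forall X Y, is_vfield X -> is_vfield Y -> f (X + Y) = f X + f Y) /\
  (forall g X, is_vfield X -> f (vscale g X) = g * f X).

Definition vlin (phi : vfield -> vfield) : Prop :=
  [/\ forall X, is_vfield X -> is_vfield (phi X),
      forall X Y, is_vfield X -> is_vfield Y -> phi (X + Y) = phi X + phi Y &
      forall g X, is_vfield X -> phi (vscale g X) = vscale g (phi X)].

Lemma slin_comb (f : vfield -> series) (I : Type) (r : seq I) (h : I -> series)
    (V : I -> vfield) : slin f -> (forall i, is_vfield (V i)) ->
  f (\sum_(i <- r) vscale (h i) (V i)) = \sum_(i <- r) h i * f (V i).
Proof.
move=> [fD fZ] vV; elim: r => [|i r IH].
  rewrite !big_nil -(mul0r (f 0)) -fZ; last exact: vfield_zero.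
  by congr f; apply/funext => i; rewrite /vscale mul0r.
by rewrite !big_cons fD // fZ // IH.
Qed.

Lemma slin_comp (f : vfield -> series) phi :
  slin f -> vlin phi -> slin (fun X => f (phi X)).
Proof.
move=> [fD fZ] [vphi phiD phiZ]; split=> [X Y vX vY|g X vX].
  by rewrite phiD // fD //; apply: vphi.
by rewrite phiZ // fZ //; apply: vphi.
Qed.

Lemma vlinN phi X : vlin phi -> is_vfield X -> phi (- X) = - phi X.
Proof. by move=> [_ _ phiZ] vX; rewrite opp_vscale phiZ // -opp_vscale. Qed.

Lemma vlin_id : vlin (fun X => X). Proof. by []. Qed.

Lemma slin_corr G (phi : vfield -> vfield) Ws Vs :
  vlin phi -> all_vfield Ws -> slin (fun X => cor G (Ws ++ phi X :: Vs)).
Proof.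
move=> lphi vWs; apply: (slin_comp (f := fun X => cor G (Ws ++ X :: Vs))) => //.
split=> [X Y vX vY|g X vX]; rewrite !corr_move //; first exact: corrD.
exact: corr_vscale.
Qed.

Lemma slin_add (f f' : vfield -> series) :
  slin f -> slin f' -> slin (fun X => f X + f' X).
Proof.
move=> [fD fZ] [fD' fZ']; split=> [X Y vX vY|g X vX].
  by rewrite fD // fD' // addrACA.
by rewrite fZ // fZ' // mulrDr.
Qed.

Lemma slin_opp (f : vfield -> series) : slin f -> slin (fun X => - f X).
Proof.
move=> [fD fZ]; split=> [X Y vX vY|g X vX]; first by rewrite fD // opprD.
by rewrite fZ // mulrN.
Qed.

Lemma slin_scale (c : K) (f : vfield -> series) :
  slin f -> slin (fun X => c *: f X).
Proof.
move=> [fD fZ]; split=> [X Y vX vY|g X vX]; first by rewrite fD // scalerDr.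
by rewrite fZ // scalerAr.
Qed.

Lemma slin_sum (I : Type) (r : seq I) (f : I -> vfield -> series) :
  (forall i, slin (f i)) -> slin (fun X => \sum_(i <- r) f i X).
Proof.
move=> lf; split=> [X Y vX vY|g X vX].
  by rewrite -big_split; apply: eq_bigr => i _; apply: (lf i).1.
by rewrite mulr_sumr; apply: eq_bigr => i _; apply: (lf i).2.
Qed.

Lemma slin_mull g (f : vfield -> series) : slin f -> slin (fun X => g * f X).
Proof.
move=> [fD fZ]; split=> [X Y vX vY|h X vX]; first by rewrite fD // mulrDr.
by rewrite fZ // mulrCA.
Qed.

Lemma slin_mulr g (f : vfield -> series) : slin f -> slin (fun X => f X * g).
Proof.
move=> [fD fZ]; split=> [X Y vX vY|h X vX]; first by rewrite fD // mulrDl.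
by rewrite fZ // mulrA.
Qed.

Lemma vlin_comb (f : 'I_n.+1 -> vfield -> series) :
  (forall c, slin (f c)) -> vlin (fun X => \sum_c vscale (f c X) (gam c)).
Proof.
move=> lf; split=> [X _|X Y vX vY|g X vX]; first exact: vfield_comb.
  rewrite -big_split; apply: eq_bigr => c _; apply/funext => i.
  by rewrite /vscale (lf c).1 //= mulrDl.
apply/funext => i; rewrite /vscale !fct_sumE mulr_sumr; apply: eq_bigr => c _.
by rewrite (lf c).2 // mulrA.
Qed.

Lemma vlin_qprodl phi Y : vlin phi -> is_vfield Y -> vlin (fun X => phi X \qp Y).
Proof.
move=> lphi vY; rewrite qmul.unlock; apply: vlin_comb => c.
exact: (@slin_corr _ _ [::]).
Qed.

Lemma vlin_qprodr phi Y : vlin phi -> is_vfield Y -> vlin (fun X => Y \qp phi X).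
Proof.
move=> lphi vY; rewrite qmul.unlock; apply: vlin_comb => c.
exact: (@slin_corr _ _ [:: Y]).
Qed.

Lemma vlin_qprod3 phi X Y :
  vlin phi -> is_vfield X -> is_vfield Y -> vlin (fun Z => qprod3 X Y (phi Z)).
Proof.
move=> lphi vX vY; rewrite qmul3.unlock; apply: vlin_comb => c.
exact: (@slin_corr _ _ [:: X; Y]).
Qed.

Lemma vlin_T : vlin T.
Proof.
have lc : vlin (fun W => \sum_a vscale (<< W, gup a >>_0) (gam a)).
  by apply: vlin_comb => a; apply: (@slin_corr _ (fun X => X) [::]).
have [_ lD lZ] := lc; rewrite trr_op.unlock.
split=> [X vX|X Y vX vY|g X vX].
- by have := vfield_T eta F vX; rewrite trr_op.unlock.
- rewrite lD // opprD addrACA; congr (_ + _).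
  by apply/funext => -[[|k] a] //=; rewrite [RHS]addr0.
- rewrite lZ //; apply/funext => -[[|k] a].
    by rewrite /vscale /= [RHS]mulrDr mulr0 mulrN.
  by rewrite /vscale /= [RHS]mulrDr mulrN.
Qed.

Lemma vlin_Tcomp phi : vlin phi -> vlin (fun X => T (phi X)).
Proof.
have [vT TD TZ] := vlin_T; move=> [vphi phiD phiZ].
split=> [X vX|X Y vX vY|g X vX]; first exact/vT/vphi.
  by rewrite phiD // TD //; apply: vphi.
by rewrite phiZ // TZ //; apply: vphi.
Qed.

Lemma slin_corr1 G phi Vs : vlin phi ->
  slin (fun X : vfield => cor G (phi X :: Vs)).
Proof. by move=> l; apply: (slin_corr G (Ws := [::]) Vs l). Qed.

Lemma slin_corr2 G phi A Vs : vlin phi -> is_vfield A ->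
  slin (fun X : vfield => cor G (A :: phi X :: Vs)).
Proof. by move=> l vA; apply: (slin_corr G (Ws := [:: A]) Vs l). Qed.

Lemma slin_corr3 G phi A A' Vs : vlin phi -> is_vfield A -> is_vfield A' ->
  slin (fun X : vfield => cor G (A :: A' :: phi X :: Vs)).
Proof. by move=> l vA vA'; apply: (slin_corr G (Ws := [:: A; A']) Vs l). Qed.

Lemma slin_corr4 G phi A A' A'' Vs :
  vlin phi -> is_vfield A -> is_vfield A' -> is_vfield A'' ->
  slin (fun X : vfield => cor G (A :: A' :: A'' :: phi X :: Vs)).
Proof.
by move=> l vA vA' vA''; apply: (slin_corr G (Ws := [:: A; A'; A'']) Vs l).
Qed.

(** * Dual bases *)

Lemma gup_comb a : gup a = \sum_b vscale ((invmx eta a b)%:A) (gam b).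
Proof. by rewrite /Defs.gup; apply: eq_bigr => b _; rewrite scale_vscale. Qed.

Hypothesis (eta_sym : eta^T = eta) (eta_unit : eta \in unitmx).

Lemma invmx_sym a b : invmx eta a b = invmx eta b a.
Proof. by rewrite -{2}eta_sym -trmx_inv mxE. Qed.

Lemma gam_comb a : gam a = \sum_b eta a b *: gup b.
Proof.
rewrite /Defs.gup; under eq_bigr do rewrite scaler_sumr.
rewrite exchange_big (bigD1 a) //= [X in _ + X]big1 ?addr0 => [|c ca].
  under eq_bigr do rewrite scalerA.
  by rewrite -scaler_suml; have /matrixP/(_ a a) := mulmxV eta_unit;
     rewrite !mxE eqxx => ->; rewrite scale1r.
under eq_bigr do rewrite scalerA.
rewrite -scaler_suml; have /matrixP/(_ a c) := mulmxV eta_unit.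
by rewrite !mxE eq_sym (negbTE ca) => ->; rewrite scale0r.
Qed.

Variable (b : vfield -> vfield -> series).
Hypothesis bl : forall Y, is_vfield Y -> slin (b^~ Y).
Hypothesis br : forall X, is_vfield X -> slin (b X).

(** The contraction does not depend on which entry is raised, as the inverse of
    eta is symmetric. *)
Lemma dual_swap : \sum_a b (gup a) (gam a) = \sum_a b (gam a) (gup a).
Proof.
transitivity (\sum_a \sum_c (invmx eta a c)%:A * b (gam c) (gam a)).
  apply: eq_bigr => a _; rewrite gup_comb.
  by rewrite (slin_comb _ _ (bl (vfield_gam L a))).
rewrite exchange_big; apply: eq_bigr => a _; rewrite gup_comb.
rewrite (slin_comb _ _ (br (vfield_gam L a))) //.
by apply: eq_bigr => c _; rewrite invmx_sym.
Qed.

(** Multiplication by X is self-adjoint for the pairing eta. *)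
Lemma dual_shift X : is_vfield X ->
  \sum_a b (X \qp gam a) (gup a) = \sum_a b (gam a) (X \qp gup a).
Proof.
move=> vX.
transitivity (\sum_a \sum_c << X, gam a, gup c >>_0 * b (gam c) (gup a)).
  apply: eq_bigr => a _; rewrite qmul.unlock.
  by rewrite (slin_comb _ _ (bl (vfield_gup L eta a))).
rewrite exchange_big; apply: eq_bigr => a _.
rewrite -(slin_comb _ _ (br (vfield_gam L a))) //; congr (b _ _).
rewrite qmul.unlock; apply/funext => i; rewrite !fct_sumE /vscale.
have E c : << X, gam c, gup a >>_0 = << X, gup a, gam c >>_0 by corr_perm.
under eq_bigr do rewrite E.
transitivity (\sum_c \sum_d (<< X, gup a, gam c >>_0 * (invmx eta c d)%:A) * gam d i).
  apply: eq_bigr => c _; rewrite (gup_comb c) fct_sumE mulr_sumr.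
  by apply: eq_bigr => d _; rewrite mulrA.
rewrite exchange_big; apply: eq_bigr => d _ /=; rewrite -mulr_suml.
have -> : << X, gup a, gup d >>_0 =
    \sum_c << X, gup a, gam c >>_0 * (invmx eta c d)%:A.
  rewrite (gup_comb d).
  rewrite (slin_comb _ _ (@slin_corr (F 0) _ [:: X; gup a] [::] vlin_id _)) //.
  by apply: eq_bigr => c _; rewrite mulrC invmx_sym.
by [].
Qed.

End Products.

Ltac lin_step :=
  match goal with
  | |- forall Y, is_vfield Y -> _ => intros ? ?
  | |- is_vfield _ => solve [repeat vfield_step]
  | |- slin (fun X => \sum_(i <- _) _) => apply: slin_sum => ?
  | |- slin (fun X => GRing.add (@?f X) (@?f' X)) =>
      refine (@slin_add _ _ _ f f' _ _)
  | |- slin (fun X => GRing.opp (@?f X)) => refine (@slin_opp _ _ _ f _)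
  | |- slin (fun X => GRing.scale ?c (@?f X)) =>
      refine (@slin_scale _ _ _ c f _)
  | |- slin (fun X => GRing.mul ?g (@?p X)) => refine (@slin_mull _ _ _ g p _)
  | |- slin (fun X => GRing.mul (@?p X) ?g) => refine (@slin_mulr _ _ _ g p _)
  | |- slin (fun X => cor ?G (@?p X :: ?Vs)) =>
      refine (@slin_corr1 _ _ _ G p Vs _)
  | |- slin (fun X => cor ?G (?A :: @?p X :: ?Vs)) =>
      refine (@slin_corr2 _ _ _ G p A Vs _ _)
  | |- slin (fun X => cor ?G (?A :: ?A' :: @?p X :: ?Vs)) =>
      refine (@slin_corr3 _ _ _ G p A A' Vs _ _ _)
  | |- slin (fun X => cor ?G (?A :: ?A' :: ?A'' :: @?p X :: ?Vs)) =>
      refine (@slin_corr4 _ _ _ G p A A' A'' Vs _ _ _ _)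
  | |- vlin (trr_op _ _) => exact: vlin_T
  | |- vlin (fun X => trr_op _ _ _) => apply: vlin_Tcomp
  | |- vlin (fun X => X) => exact: vlin_id
  | |- vlin (fun X => qmul _ _ _ ?Y) => apply: vlin_qprodl
  | |- vlin (fun X => qmul _ _ ?Y _) => apply: vlin_qprodr
  | |- vlin (fun X => qmul3 _ _ ?Y ?Z _) => apply: vlin_qprod3
  end.
Ltac lin := cbv beta; repeat lin_step.

Section Recursion.
Variables (K : fieldType) (L : comAlgType K) (n : nat).
Variables (eta : 'M[K]_n.+1).
Notation series := (fps L (bps n)).
Notation vfield := (bps n -> series).
Notation gup := (gup L eta).
Notation gam := (gam L).
Implicit Types (U V W X Y Z w x y z : vfield) (f g : series) (Ws Vs Cs : seq vfield).

(** * Covariant derivatives *)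

Lemma vact0 U : vact U 0 = 0.
Proof. by apply: fsum0 => i; rewrite raddf0 mulr0. Qed.

Lemma vact1 U : is_vfield U -> vact U 1 = 0.
Proof.
move=> vU; have := @vactM _ _ _ _ 1 1 vU; rewrite !mul1r mulr1 => /eqP.
by rewrite -subr_eq subrr => /eqP <-.
Qed.

Lemma vactN U f : is_vfield U -> vact U (- f) = - vact U f.
Proof.
move=> vU; apply/eqP; rewrite -addr_eq0 -vactD // addrC subrr.
exact/eqP/vact0.
Qed.

Lemma vact_sum U (I : Type) (r : seq I) (f : I -> series) : is_vfield U ->
  vact U (\sum_(i <- r) f i) = \sum_(i <- r) vact U (f i).
Proof.
move=> vU; elim: r => [|i r IH]; first by rewrite !big_nil vact0.
by rewrite !big_cons vactD // IH.
Qed.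

Lemma vact_gam U a i : is_vfield U -> vact U (gam a i) = 0.
Proof. by move=> vU; rewrite /Defs.gam; case: eqP => _; rewrite ?vact1 ?vact0. Qed.

Lemma vactZ U (c : K) f : is_vfield U -> vact U (c *: f) = c *: vact U f.
Proof.
move=> vU; have E g : c *: g = c%:A * g by rewrite -scalerAl mul1r.
rewrite E vactM // -E; suff -> : vact U (c%:A) = 0 by rewrite mul0r add0r.
apply: fsum0 => i; suff -> : fderiv i (c%:A : series) = 0 by rewrite mulr0.
apply/fpsP => m'; rewrite [LHS]/= (_ : _ == _ = false) ?scaler0 ?mul0rn //.
by apply/negbTE/eqP => /msetP/(_ i); rewrite mset1DE mset0E eqxx.
Qed.

Lemma nablaD U V W : is_vfield U -> nabla U (V + W) = nabla U V + nabla U W.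
Proof. by move=> vU; apply/funext => i; exact: (vactD (V i) (W i) vU). Qed.

Lemma nablaN U V : is_vfield U -> nabla U (- V) = - nabla U V.
Proof. by move=> vU; apply/funext => i; exact: (vactN (V i) vU). Qed.

Lemma nabla_comb U (h : 'I_n.+1 -> series) : is_vfield U ->
  nabla U (\sum_a vscale (h a) (gam a)) = \sum_a vscale (vact U (h a)) (gam a).
Proof.
move=> vU; apply/funext => i; rewrite /nabla !fct_sumE vact_sum //.
by apply: eq_bigr => a _; rewrite /vscale vactM // vact_gam // mulr0 addr0.
Qed.

Lemma comb_coef (h : 'I_n.+1 -> series) a :
  (\sum_c vscale (h c) (gam c) : vfield) (0%N, a) = h a.
Proof.
rewrite fct_sumE (bigD1 a) //= big1 /vscale /Defs.gam => [|c ca].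
  by rewrite eqxx mulr1 addr0.
by rewrite xpair_eqE /= eq_sym (negbTE ca) mulr0.
Qed.

(** The primary fields with constant coefficients.  They are parallel for nabla,
    and the recursion relation T W \qp X = 0 amounts to the vanishing of
    << T W, X, w >>_0 for all of them. *)
Definition flat w : Prop :=
  exists k : 'I_n.+1 -> K, w = \sum_a vscale ((k a)%:A) (gam a).

Lemma flat_gup a : flat (gup a).
Proof. by exists (invmx eta a); rewrite gup_comb. Qed.

Lemma flat_gam a : flat (gam a).
Proof.
exists (fun c => (c == a)%:R); rewrite (bigD1 a) //= eqxx big1 => [|c ca].
  by rewrite addr0 scale1r; apply/funext => i; rewrite /vscale mul1r.
by rewrite (negbTE ca) scale0r; apply/funext => i; rewrite /vscale mul0r.
Qed.

Lemma vfield_flat w : flat w -> is_vfield w.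
Proof. by case=> k ->; apply: vfield_comb. Qed.

Lemma nabla_flat U w : is_vfield U -> flat w -> nabla U w = 0.
Proof.
move=> vU [k ->]; rewrite nabla_comb //; apply: big1 => a _.
rewrite vactZ // vact1 // scaler0; apply/funext => i.
by rewrite /vscale mul0r.
Qed.

Fixpoint all_flat Cs : Prop :=
  if Cs is c :: Cs' then flat c /\ all_flat Cs' else True.

(** Flat entries commute with partial derivatives, hence can be absorbed in the
    potential. *)
Lemma fderiv_corr_flat i G Cs : all_flat Cs ->
  fderiv i (cor G Cs) = cor (fderiv i G) Cs.
Proof.
elim: Cs G => [|c Cs IH] G; first by rewrite !corr_nil.
move=> [[k ->] fCs].
rewrite !corr_sum; [|by move=> a..].
rewrite raddf_sum; apply: eq_bigr => a _.
rewrite !corr_vscale; [|exact: vfield_gam..].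
rewrite !corr_gam fderivC -IH // -!scalerAl !mul1r.
by apply/fpsP => m; rewrite /= scalerMnr.
Qed.

Lemma corr_cat_flat G Ws Cs : all_flat Cs ->
  cor G (Ws ++ Cs) = cor (cor G Cs) Ws.
Proof.
move=> fCs; elim: Ws G => [|W Ws IH] G; first by rewrite corr_nil.
rewrite cat_cons !corr_cons; apply: eq_fsum => i.
by rewrite IH fderiv_corr_flat.
Qed.

Lemma vact_flat U G Ws Cs : is_vfield U -> all_vfield Ws -> all_flat Cs ->
  vact U (cor G (Ws ++ Cs)) = cor G (U :: Ws ++ Cs) +
    \sum_(Vs <- nabla_entries U Ws) cor G (Vs ++ Cs).
Proof.
move=> vU vWs fCs; rewrite corr_cat_flat // vact_corr //.
rewrite -cat_cons corr_cat_flat //; congr (_ + _).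
by apply: eq_bigr => Vs _; rewrite corr_cat_flat.
Qed.

End Recursion.

(** * Recursion in genus zero *)

Section GenusZero.
Variables (K : fieldType) (L : comAlgType K) (n : nat).
Variables (eta : 'M[K]_n.+1) (F : nat -> fps L (bps n)).
Notation series := (fps L (bps n)).
Notation vfield := (bps n -> series).
Notation "'<<' W , .. , V '>>_' g" := (cor (F g%N) (cons W .. (cons V nil) ..))
  (at level 0, W at level 99, V at level 99, g at level 0).
Notation "U \qp W" := (qmul eta F U W) (at level 40, left associativity).
Notation gup := (gup L eta).
Notation gam := (gam L).
Notation T := (trr_op eta F).
Notation qprod3 := (qmul3 eta F).
Implicit Types (U V W X Y Z w x y z u : vfield) (f g : series) (Ws Vs Cs : seq vfield).

(** Turns an equation p = q that implies the goal linearly into a goal for ring. *)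
Lemma eq_of_sub (A : zmodType) (p q s t : A) : p = q -> s - t = p - q -> s = t.
Proof. by move=> -> /eqP; rewrite subrr subr_eq0 => /eqP. Qed.

Lemma corrB G V W Ws : is_vfield V -> is_vfield W ->
  cor G (V - W :: Ws) = cor G (V :: Ws) - cor G (W :: Ws).
Proof. by move=> vV vW; rewrite corrD // corrN. Qed.

Lemma corr_zero G Ws : cor G ((0 : vfield) :: Ws) = 0.
Proof. by rewrite corr_cons; apply: fsum0 => i; rewrite mul0r. Qed.

Lemma combD (h h' : 'I_n.+1 -> series) :
  \sum_a vscale (h a + h' a) (gam a) =
  \sum_a vscale (h a) (gam a) + \sum_a vscale (h' a) (gam a) :> vfield.
Proof.
rewrite -big_split; apply: eq_bigr => a _; apply/funext => i.
by rewrite /vscale /= mulrDl.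
Qed.

Lemma eq_comb (h h' : 'I_n.+1 -> series) : (forall a, h a = h' a) ->
  \sum_a vscale (h a) (gam a) = \sum_a vscale (h' a) (gam a) :> vfield.
Proof. by move=> E; apply: eq_bigr => a _; rewrite E. Qed.

Lemma comb0 (h : 'I_n.+1 -> series) : (forall a, h a = 0) ->
  \sum_a vscale (h a) (gam a) = 0 :> vfield.
Proof.
move=> h0; apply: big1 => a _; apply/funext => i.
by rewrite /vscale h0 mul0r.
Qed.

Lemma eq_qprod X Y X' Y' :
  (forall a, << X, Y, gup a >>_0 = << X', Y', gup a >>_0) -> X \qp Y = X' \qp Y'.
Proof. by move=> E; rewrite !qmul.unlock; apply: eq_comb. Qed.

Lemma eq_qprod3_qprod X Y Z X' Y' :
  (forall a, << X, Y, Z, gup a >>_0 = << X', Y', gup a >>_0) ->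
  qprod3 X Y Z = X' \qp Y'.
Proof. by move=> E; rewrite qmul3.unlock qmul.unlock; apply: eq_comb. Qed.

Lemma eq_qprod3 X Y Z X' Y' Z' :
  (forall a, << X, Y, Z, gup a >>_0 = << X', Y', Z', gup a >>_0) ->
  qprod3 X Y Z = qprod3 X' Y' Z'.
Proof. by move=> E; rewrite !qmul3.unlock; apply: eq_comb. Qed.

Lemma qprodC U W : is_vfield U -> is_vfield W -> U \qp W = W \qp U.
Proof. by move=> vU vW; apply: eq_qprod => a; corr_perm. Qed.

Lemma qprodDl U V W : is_vfield U -> is_vfield V ->
  (U + V) \qp W = U \qp W + V \qp W.
Proof.
by move=> vU vV; rewrite qmul.unlock -combD; apply: eq_comb => a; rewrite corrD.
Qed.

Lemma qprod0 W : is_vfield W -> W \qp 0 = 0.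
Proof.
move=> vW; rewrite qprodC //; last exact: vfield_zero.
by rewrite qmul.unlock comb0 // => a; rewrite corr_zero.
Qed.

Lemma T_add V W : is_vfield V -> is_vfield W -> T (V + W) = T V + T W.
Proof. by have [_ TD _] := vlin_T eta F; apply: TD. Qed.

Lemma T_opp W : is_vfield W -> T (- W) = - T W.
Proof. by apply: vlinN; apply: vlin_T. Qed.

Lemma nabla_qprod U X Y : is_vfield U -> is_vfield X -> is_vfield Y ->
  nabla U (X \qp Y) = qprod3 U X Y + nabla U X \qp Y + X \qp nabla U Y.
Proof.
move=> vU vX vY; rewrite !qmul.unlock qmul3.unlock nabla_comb // -!combD.
apply: eq_comb => a.
rewrite (vact_flat _ (Ws := [:: X; Y]) (Cs := [:: gup a])) //.
  by rewrite /= !big_cons big_nil addr0 addrA.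
by split=> //; exact: flat_gup.
Qed.

(** The failure of T to be parallel is the quantum product: it comes from the
    derivative of the coefficients << W, gup a >>_0 in T W.  All the recursion
    relations with more entries below follow from it by differentiation. *)
Lemma nabla_T U W : is_vfield U -> is_vfield W ->
  nabla U (T W) = T (nabla U W) - U \qp W.
Proof.
move=> vU vW; rewrite trr_op.unlock qmul.unlock nablaD ?nablaN ?nabla_comb //.
have -> : nabla U (tau_shift W) = tau_shift (nabla U W).
  by apply/funext => -[[|k] a] //=; apply: vact0.
rewrite -addrA -opprD; congr (_ - _); rewrite -combD; apply: eq_comb => a.
rewrite (vact_flat _ (Ws := [:: W]) (Cs := [:: gup a])) //.
  by rewrite /= big_cons big_nil addr0 addrC.
by split=> //; exact: flat_gup.
Qed.

Lemma qprod_coef U W a : (U \qp W) (0%N, a) = << U, W, gup a >>_0.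
Proof. by rewrite qmul.unlock comb_coef. Qed.

Lemma corr_comb G (h : 'I_n.+1 -> series) Ws :
  cor G (\sum_a vscale (h a) (gam a) :: Ws) = \sum_a h a * cor G (gam a :: Ws).
Proof.
rewrite corr_sum => [|a]; last by [].
by apply: eq_bigr => a _; rewrite corr_vscale.
Qed.

Lemma corr_qprod G X Y Ws :
  cor G (X \qp Y :: Ws) = \sum_a << X, Y, gup a >>_0 * cor G (gam a :: Ws).
Proof. by rewrite qmul.unlock corr_comb. Qed.

Lemma corr_qprod3 G X Y Z Ws :
  cor G (qprod3 X Y Z :: Ws) =
    \sum_a << X, Y, Z, gup a >>_0 * cor G (gam a :: Ws).
Proof. by rewrite qmul3.unlock corr_comb. Qed.

Lemma corr_nabla_T G U W Ws : is_vfield U -> is_vfield W ->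
  cor G (nabla U (T W) :: Ws) =
  cor G (T (nabla U W) :: Ws) - cor G (U \qp W :: Ws).
Proof. by move=> vU vW; rewrite nabla_T // corrB. Qed.

Lemma corr_nabla_qprod G U X Y Ws :
  is_vfield U -> is_vfield X -> is_vfield Y ->
  cor G (nabla U (X \qp Y) :: Ws) = cor G (qprod3 U X Y :: Ws)
    + cor G (nabla U X \qp Y :: Ws) + cor G (X \qp nabla U Y :: Ws).
Proof. by move=> vU vX vY; rewrite nabla_qprod // !corrD. Qed.

Hypotheses (eta_sym : eta^T = eta) (eta_unit : eta \in unitmx).
Hypothesis TRR0 : forall W V, is_vfield W -> is_vfield V -> T W \qp V = 0.

Lemma trr3 W X w : is_vfield W -> is_vfield X -> flat w ->
  << T W, X, w >>_0 = 0.
Proof.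
move=> vW vX.
have gup0 a : << T W, X, gup a >>_0 = 0.
  have := TRR0 vW vX => /(congr1 (fun V => V (0%N, a))).
  by rewrite qprod_coef.
have gam0 a : << T W, X, gam a >>_0 = 0.
  rewrite (gam_comb _ eta_unit).
  under eq_bigr do rewrite scale_vscale.
  rewrite (slin_comb _ _ (slin_corr (F 0) (Ws := [:: T W; X]) [::] (vlin_id _ _) _)) //.
  by rewrite big1 // => c _; rewrite /= gup0 mulr0.
move=> [k ->].
rewrite (slin_comb _ _ (slin_corr (F 0) (Ws := [:: T W; X]) [::] (vlin_id _ _) _)) //.
by rewrite big1 // => c _; rewrite /= gam0 mulr0.
Qed.

Lemma qprod_Tr W X : is_vfield W -> is_vfield X -> X \qp T W = 0.
Proof. by move=> vW vX; rewrite qprodC // TRR0. Qed.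

(** The derivative of trr3 along X. *)
Lemma trr4 W X Y w : is_vfield W -> is_vfield X -> is_vfield Y -> flat w ->
  << T W, X, Y, w >>_0 = << W \qp X, Y, w >>_0.
Proof.
move=> vW vX vY fw; have vw := vfield_flat fw.
have := congr1 (vact X) (trr3 vW vY fw).
rewrite (vact_flat _ (Ws := [:: T W; Y]) (Cs := [:: w])) // vact0.
rewrite /= !big_cons big_nil corr_nabla_T // !trr3 // (qprodC vX) // => H.
have -> : << T W, X, Y, w >>_0 = << X, T W, Y, w >>_0 by corr_perm.
by apply: (eq_of_sub H); ring.
Qed.

(** The derivative of trr4 along Z. *)
Lemma trr5 W X Y Z w :
  is_vfield W -> is_vfield X -> is_vfield Y -> is_vfield Z -> flat w ->
  << T W, X, Y, Z, w >>_0 = << Z \qp W, X, Y, w >>_0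
    + << qprod3 Z W X, Y, w >>_0 + << W \qp X, Y, Z, w >>_0.
Proof.
move=> vW vX vY vZ fw; have vw := vfield_flat fw.
have := congr1 (vact Z) (trr4 vW vX vY fw).
rewrite (vact_flat _ (Ws := [:: T W; X; Y]) (Cs := [:: w])) //.
rewrite (vact_flat _ (Ws := [:: W \qp X; Y]) (Cs := [:: w])) //.
rewrite /= !big_cons !big_nil corr_nabla_T // !trr4 // corr_nabla_qprod // => H.
have -> : << T W, X, Y, Z, w >>_0 = << Z, T W, X, Y, w >>_0 by corr_perm.
have -> : << W \qp X, Y, Z, w >>_0 = << Z, W \qp X, Y, w >>_0 by corr_perm.
by apply: (eq_of_sub H); ring.
Qed.

(** * Associativity of the quantum product *)

#[local] Hint Extern 0 (flat _) => solve [exact: flat_gam | exact: flat_gup] : core.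

(** Both sides are << T W, X, Y, w >>_0, which is symmetric in X and Y; this is
    associativity, up to commutativity. *)
Lemma corr3_swap W X Y w : is_vfield W -> is_vfield X -> is_vfield Y -> flat w ->
  << W \qp X, Y, w >>_0 = << W \qp Y, X, w >>_0.
Proof.
move=> vW vX vY fw; have vw := vfield_flat fw.
by rewrite -!trr4 //; corr_perm.
Qed.

Lemma qprodAC W X Y : is_vfield W -> is_vfield X -> is_vfield Y ->
  W \qp X \qp Y = W \qp Y \qp X.
Proof. by move=> vW vX vY; apply: eq_qprod => a; apply: corr3_swap. Qed.

Lemma qprodA W X Y : is_vfield W -> is_vfield X -> is_vfield Y ->
  W \qp (X \qp Y) = W \qp X \qp Y.
Proof.
by move=> vW vX vY; rewrite qprodC // qprodAC // (qprodC vX) //.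
Qed.

(** The derivative of associativity along u. *)
Lemma wdvv u x y z w :
  is_vfield u -> is_vfield x -> is_vfield y -> is_vfield z -> flat w ->
  << qprod3 u x y, z, w >>_0 + << u, x \qp y, z, w >>_0 =
  << qprod3 u y z, x, w >>_0 + << u, x, y \qp z, w >>_0.
Proof.
move=> vu vx vy vz fw; have vw := vfield_flat fw.
have E x' y' z' : is_vfield x' -> is_vfield y' -> is_vfield z' ->
    << x' \qp y', z', w >>_0 = << y' \qp z', x', w >>_0.
  by move=> vx' vy' vz'; rewrite (qprodC vx') // corr3_swap.
have := congr1 (vact u) (E x y z vx vy vz).
rewrite (vact_flat _ (Ws := [:: x \qp y; z]) (Cs := [:: w])) //.
rewrite (vact_flat _ (Ws := [:: y \qp z; x]) (Cs := [:: w])) //.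
rewrite /= !big_cons !big_nil !corr_nabla_qprod //.
rewrite (E (nabla u x)) // (E x (nabla u y)) // (E x y (nabla u z)) // => H.
have -> : << u, x, y \qp z, w >>_0 = << u, y \qp z, x, w >>_0 by corr_perm.
by apply: (eq_of_sub H); ring.
Qed.

(** * Contractions of four-point functions *)

Lemma dual_shift_gup (b : vfield -> vfield -> series) X :
  (forall Y, is_vfield Y -> slin (b^~ Y)) ->
  (forall Y, is_vfield Y -> slin (b Y)) -> is_vfield X ->
  \sum_a b (X \qp gup a) (gam a) = \sum_a b (gup a) (X \qp gam a).
Proof.
move=> bl br vX.
have lX : vlin (fun Y => X \qp Y) by lin.
have [vl _ _] := lX.
have cX (f : vfield -> series) : slin f -> slin (fun Y => f (X \qp Y)).
  by move=> lf; apply: (slin_comp lf lX).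
have [s1 s2] : (forall Y, is_vfield Y -> slin (fun P => b (X \qp P) Y)) /\
    (forall Y, is_vfield Y -> slin (b (X \qp Y))).
  by split=> Y vY; [exact: (cX _ (bl _ vY)) | exact/br/vl].
have [s3 s4] : (forall Y, is_vfield Y -> slin (fun P => b P (X \qp Y))) /\
    (forall Y, is_vfield Y -> slin (fun P => b Y (X \qp P))).
  by split=> Y vY; [exact/bl/vl | exact: (cX _ (br _ vY))].
rewrite (dual_swap eta_sym (b := fun P Q => b (X \qp P) Q)) //.
rewrite (dual_shift F eta_sym bl br) //.
by rewrite -(dual_swap eta_sym (b := fun P Q => b P (X \qp Q))).
Qed.

(** The contraction of dual bases with the quantum product; it represents the
    trace of quantum multiplication. *)
Definition Delta : vfield := \sum_a gup a \qp gam a.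

Lemma vfield_Delta : is_vfield Delta.
Proof. by apply: vfield_sum => a. Qed.
#[local] Hint Extern 0 (is_vfield Delta) => exact: vfield_Delta : core.

Lemma corr_Delta G Ws :
  cor G (Delta :: Ws) = \sum_a cor G (gup a \qp gam a :: Ws).
Proof. by apply: corr_sum => a. Qed.

(** Both sides contract << u, y, z, - >>_0 with << -, x, w >>_0. *)
Lemma qprod3_pair u y z x w :
  is_vfield u -> is_vfield y -> is_vfield z -> is_vfield x -> is_vfield w ->
  << qprod3 u y z, x, w >>_0 = << u, y, z, x \qp w >>_0.
Proof.
move=> vu vy vz vx vw; rewrite corr_qprod3.
have -> : << u, y, z, x \qp w >>_0 = << x \qp w, u, y, z >>_0 by corr_perm.
rewrite corr_qprod.
rewrite (dual_swap eta_sym (b := fun P Q => << u, y, z, P >>_0 * << Q, x, w >>_0));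
  [|by lin..].
apply: eq_bigr => a _; rewrite mulrC.
have -> : << u, y, z, gam a >>_0 = << gam a, u, y, z >>_0 by corr_perm.
by have -> : << gup a, x, w >>_0 = << x, w, gup a >>_0 by corr_perm.
Qed.

Lemma trace_qprod3 x y z : is_vfield x -> is_vfield y -> is_vfield z ->
  \sum_a << qprod3 x y z, gup a, gam a >>_0 = << x, y, z, Delta >>_0.
Proof.
move=> vx vy vz; have vD := vfield_Delta.
have -> : << x, y, z, Delta >>_0 = << Delta, x, y, z >>_0 by corr_perm.
rewrite corr_Delta; apply: eq_bigr => a _; rewrite qprod3_pair //.
by corr_perm.
Qed.

(** The trace over z and w of wdvv. *)
Lemma wdvv_trace u x y : is_vfield u -> is_vfield x -> is_vfield y ->
  << u, x, y, Delta >>_0 + \sum_a << u, x \qp y, gup a, gam a >>_0 =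
  \sum_a << u, y, gup a, x \qp gam a >>_0
  + \sum_a << u, x, gup a, y \qp gam a >>_0.
Proof.
move=> vu vx vy; rewrite -trace_qprod3 // -big_split /=.
under eq_bigr do rewrite wdvv //.
rewrite big_split /=; congr (_ + _).
  by apply: eq_bigr => a _; rewrite qprod3_pair.
by apply: (dual_shift_gup (b := fun P Q => << u, x, P, Q >>_0)) => //; lin.
Qed.

Definition tr4 X Y : series := \sum_a << X, Y, gup a, gam a >>_0.

Lemma tr4C X Y : is_vfield X -> is_vfield Y -> tr4 X Y = tr4 Y X.
Proof. by move=> vX vY; apply: eq_bigr => a _; corr_perm. Qed.

Lemma corr_DeltaE G A A' A'' : is_vfield A -> is_vfield A' -> is_vfield A'' ->
  cor G [:: A; A'; A''; Delta] = \sum_a cor G [:: A; A'; A''; gup a \qp gam a].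
Proof.
move=> vA vA' vA''.
have -> : cor G [:: A; A'; A''; Delta] = cor G [:: Delta; A; A'; A''] by corr_perm.
by rewrite corr_Delta; apply: eq_bigr => a _; corr_perm.
Qed.

(** The four-point functions contracted twice with eta to which the genus-zero
    terms reduce.  Each corresponds to a stable graph with two loops, legs V and
    W and genus-zero vertices, all trivalent except one of valence four; so do
    << V, W, Delta, Delta >>_0 and tr4 (V \qp W) Delta, which also occur.  The
    relations quad_rel1 to quad_rel5 come from instances of wdvv_trace, summed
    over dual bases in the last two. *)
Section Pair.
Variables (V W : vfield).
Hypotheses (vV : is_vfield V) (vW : is_vfield W).

Definition quad_Delta X Y : series := tr4 (X \qp Delta) Y.
Definition quad_prod : series := \sum_a tr4 (V \qp W \qp gup a) (gam a).
Definition quad_split : series := \sum_a tr4 (V \qp gup a) (W \qp gam a).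
Definition quad_shift X Y : series := \sum_a << X, Delta, gup a, Y \qp gam a >>_0.
Definition quad_cross : series :=
  \sum_a \sum_b << V \qp W, gup a, gup b, gam a \qp gam b >>_0.
Definition quad_pair : series := \sum_a << V, W, gup a, Delta \qp gam a >>_0.

Lemma eq_sum (f g : 'I_n.+1 -> series) : f =1 g -> \sum_a f a = \sum_a g a.
Proof. by move=> E; apply: eq_bigr => a _. Qed.

Lemma quad_rel1 : << V, W, Delta, Delta >>_0 + quad_Delta W V = quad_shift V W + quad_pair.
Proof.
rewrite /quad_shift -wdvv_trace //; congr (_ + _).
by apply: eq_bigr => a _; corr_perm.
Qed.

Lemma quad_rel2 : << V, W, Delta, Delta >>_0 + quad_Delta V W = quad_shift W V + quad_pair.
Proof.
have -> : << V, W, Delta, Delta >>_0 = << W, V, Delta, Delta >>_0 by corr_perm.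
have -> : quad_Delta V W = \sum_a << W, V \qp Delta, gup a, gam a >>_0.
  by apply: eq_bigr => a _; corr_perm.
have -> : quad_pair = \sum_a << W, V, gup a, Delta \qp gam a >>_0.
  by apply: eq_bigr => a _; corr_perm.
exact: wdvv_trace.
Qed.

Lemma quad_rel3 : << V, W, Delta, Delta >>_0 + tr4 (V \qp W) Delta =
  quad_shift V W + quad_shift W V.
Proof.
have -> : << V, W, Delta, Delta >>_0 = << Delta, V, W, Delta >>_0 by corr_perm.
have -> : tr4 (V \qp W) Delta = tr4 Delta (V \qp W) by exact: tr4C.
rewrite [quad_shift V W + _]addrC.
have E X Y : is_vfield X -> is_vfield Y ->
    quad_shift X Y = \sum_a << Delta, X, gup a, Y \qp gam a >>_0.
  by move=> vX vY; apply: eq_bigr => a _; corr_perm.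
rewrite !E //; exact: wdvv_trace.
Qed.

Lemma quad_rel4 : tr4 (V \qp W) Delta + tr4 (V \qp W) Delta = quad_cross + quad_cross.
Proof.
have vp : is_vfield (V \qp W) by [].
have := eq_sum (fun a => wdvv_trace vp (vfield_gup L eta a) (vfield_gam L a)).
rewrite !big_split /=.
have -> : \sum_a << V \qp W, gup a, gam a, Delta >>_0 = tr4 (V \qp W) Delta.
  by apply: eq_bigr => a _; corr_perm.
have -> : \sum_a \sum_b << V \qp W, gup a \qp gam a, gup b, gam b >>_0 =
    tr4 (V \qp W) Delta.
  rewrite exchange_big; apply: eq_bigr => b _ /=.
  have -> : << V \qp W, Delta, gup b, gam b >>_0 =
    << V \qp W, gup b, gam b, Delta >>_0 by corr_perm.
  by rewrite corr_DeltaE //; apply: eq_bigr => a _; corr_perm.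
move=> ->; congr (_ + _).
rewrite -(dual_swap eta_sym (b := fun P Q =>
  \sum_b << V \qp W, P, gup b, Q \qp gam b >>_0)) //; by lin.
Qed.

(** The fields V \qp gup a, W, gam a and gup a, W, V \qp gam a give relations whose
    other terms agree by dual_shift_gup. *)
Lemma quad_rel5 : quad_prod = quad_split.
Proof.
have := eq_sum (fun a =>
  wdvv_trace (vfield_qprod eta F V (gup a)) vW (vfield_gam L a)).
have := eq_sum (fun a =>
  wdvv_trace (vfield_gup L eta a) vW (vfield_qprod eta F V (gam a))).
rewrite !big_split /= => H1 H2.
have S (b : vfield -> vfield -> series) :
    (forall Y, is_vfield Y -> slin (b^~ Y)) ->
    (forall Y, is_vfield Y -> slin (b Y)) ->
    \sum_a b (V \qp gup a) (gam a) = \sum_a b (gup a) (V \qp gam a).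
  by move=> bl br; exact: dual_shift_gup.
have -> : quad_split = \sum_a \sum_b << V \qp gup a, W \qp gam a, gup b, gam b >>_0.
  by [].
have -> : quad_prod =
    \sum_a \sum_b << gup a, W \qp (V \qp gam a), gup b, gam b >>_0.
  rewrite /quad_prod /tr4.
  rewrite (dual_swap eta_sym (b := fun P Q =>
    \sum_b << V \qp W \qp P, Q, gup b, gam b >>_0)); [|by lin..].
  apply: eq_bigr => a _; apply: eq_bigr => b _; rewrite qprodA // (qprodC vW) //.
  by corr_perm.
apply: (addrI (\sum_a << gup a, W, V \qp gam a, Delta >>_0)); rewrite H1.
rewrite -(S (fun P Q => << P, W, Q, Delta >>_0)); [|by lin..]; rewrite H2.
congr (_ + _).
  by rewrite (S (fun P Q => \sum_b << P, Q, gup b, W \qp gam b >>_0)) //; by lin.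
by rewrite (S (fun P Q => \sum_b << P, W, gup b, Q \qp gam b >>_0)) //; by lin.
Qed.

End Pair.

(** * Five- and six-point functions in genus zero *)

Lemma qprod3_T V X Y : is_vfield V -> is_vfield X -> is_vfield Y ->
  qprod3 (T V) X Y = V \qp X \qp Y.
Proof. by move=> vV vX vY; apply: eq_qprod3_qprod => a; rewrite trr4. Qed.

(** The product W \qp T V drops out of trr5, and trr4 collapses each of the two
    other terms to the same value. *)
Lemma corr5_TT V W x y z : is_vfield V -> is_vfield W ->
  flat x -> flat y -> flat z ->
  << T W, T V, x, y, z >>_0 =
  << V \qp W \qp x, y, z >>_0 + << V \qp W \qp x, y, z >>_0.
Proof.
move=> vV vW fx fy fz.
have [[vx vy] vz] := ((vfield_flat fx, vfield_flat fy), vfield_flat fz).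
rewrite trr5 // qprod_Tr // corr_zero addr0.
have -> : qprod3 y W (T V) = qprod3 (T V) W y.
  by apply: eq_qprod3 => a; corr_perm.
have -> : << y \qp W, T V, x, z >>_0 = << T V, y \qp W, x, z >>_0 by corr_perm.
rewrite trr4 // qprod3_T // (qprodC vy) // qprodA //.
by rewrite (corr3_swap (Y := x)).
Qed.

Lemma corr5_T2 V W x y z : is_vfield V -> is_vfield W ->
  flat x -> flat y -> flat z ->
  << T (T V), W, x, y, z >>_0 = << V \qp W \qp x, y, z >>_0.
Proof.
move=> vV vW fx fy fz.
have [[vx vy] vz] := ((vfield_flat fx, vfield_flat fy), vfield_flat fz).
rewrite trr5 // qprod_Tr // corr_zero add0r TRR0 // corr_zero addr0.
have -> : qprod3 y (T V) W = qprod3 (T V) W y.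
  by apply: eq_qprod3 => a; corr_perm.
by rewrite qprod3_T // (corr3_swap (Y := x)).
Qed.

Lemma vact_qprod2 U V W x y z : is_vfield U -> is_vfield V -> is_vfield W ->
  flat x -> flat y -> flat z ->
  vact U << V \qp W \qp x, y, z >>_0 = << V \qp W \qp x, y, z, U >>_0
   + << qprod3 U (V \qp W) x, y, z >>_0 + << qprod3 U V W \qp x, y, z >>_0
   + << nabla U V \qp W \qp x, y, z >>_0 + << V \qp nabla U W \qp x, y, z >>_0.
Proof.
move=> vU vV vW fx fy fz.
have [[vx vy] vz] := ((vfield_flat fx, vfield_flat fy), vfield_flat fz).
rewrite (vact_flat _ (Ws := [:: V \qp W \qp x]) (Cs := [:: y; z])) //.
rewrite /= !big_cons big_nil corr_nabla_qprod // nabla_qprod //.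
rewrite (nabla_flat vU fx) !qprodDl // !corrD //.
rewrite qprod0 // corr_zero.
have -> : << U, V \qp W \qp x, y, z >>_0 = << V \qp W \qp x, y, z, U >>_0.
  by corr_perm.
by ring.
Qed.

(** The derivative of corr5_TT along u. *)
Lemma corr6_TT V W x y z u : is_vfield V -> is_vfield W ->
  flat x -> flat y -> flat z -> flat u ->
  << T W, T V, x, y, z, u >>_0 =
    << T V, u \qp W, x, y, z >>_0 + << T W, u \qp V, x, y, z >>_0
    + (<< V \qp W \qp x, y, z, u >>_0 + << qprod3 u (V \qp W) x, y, z >>_0
       + << qprod3 u V W \qp x, y, z >>_0) *+ 2.
Proof.
move=> vV vW fx fy fz fu; have vu := vfield_flat fu.
have [[vx vy] vz] := ((vfield_flat fx, vfield_flat fy), vfield_flat fz).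
have := congr1 (vact u) (corr5_TT vV vW fx fy fz).
rewrite (vact_flat _ (Ws := [:: T W; T V]) (Cs := [:: x; y; z])) //.
rewrite vactD // !vact_qprod2 // /= !big_cons big_nil.
have -> : << T W, nabla u (T V), x, y, z >>_0 = << nabla u (T V), T W, x, y, z >>_0.
  by corr_perm.
rewrite !corr_nabla_T // !corr5_TT // (qprodC (U := W)) //.
have -> : << u, T W, T V, x, y, z >>_0 = << T W, T V, x, y, z, u >>_0 by corr_perm.
have -> : << u \qp W, T V, x, y, z >>_0 = << T V, u \qp W, x, y, z >>_0 by corr_perm.
have -> : << u \qp V, T W, x, y, z >>_0 = << T W, u \qp V, x, y, z >>_0 by corr_perm.
by move=> H; apply: (eq_of_sub H); ring.
Qed.

(** The derivative of corr5_T2 along u. *)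
Lemma corr6_T2 V W x y z u : is_vfield V -> is_vfield W ->
  flat x -> flat y -> flat z -> flat u ->
  << T (T V), W, x, y, z, u >>_0 = << T (u \qp V), W, x, y, z >>_0
    + (<< V \qp W \qp x, y, z, u >>_0 + << qprod3 u (V \qp W) x, y, z >>_0
       + << qprod3 u V W \qp x, y, z >>_0).
Proof.
move=> vV vW fx fy fz fu; have vu := vfield_flat fu.
have [[vx vy] vz] := ((vfield_flat fx, vfield_flat fy), vfield_flat fz).
have := congr1 (vact u) (corr5_T2 vV vW fx fy fz).
rewrite (vact_flat _ (Ws := [:: T (T V); W]) (Cs := [:: x; y; z])) //.
rewrite vact_qprod2 // /= !big_cons big_nil.
rewrite corr_nabla_T // qprod_Tr // corr_zero nabla_T // T_add // T_opp //.
rewrite corrB // !corr5_T2 //.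
have -> : << u, T (T V), W, x, y, z >>_0 = << T (T V), W, x, y, z, u >>_0 by corr_perm.
by move=> H; apply: (eq_of_sub H); ring.
Qed.

Lemma trace5_T V Q Z : is_vfield V -> is_vfield Q -> is_vfield Z ->
  \sum_a << T V, Q, Z, gup a, gam a >>_0 =
  tr4 (Z \qp V) Q + << Z, V, Q, Delta >>_0 + tr4 (V \qp Q) Z.
Proof.
move=> vV vQ vZ; rewrite -trace_qprod3 // -!big_split; apply: eq_bigr => a _.
have -> : << T V, Q, Z, gup a, gam a >>_0 = << T V, Q, gup a, Z, gam a >>_0.
  by corr_perm.
rewrite trr5 //=; congr (_ + _).
by corr_perm.
Qed.

Lemma slin_Delta (f : vfield -> series) : slin f ->
  f Delta = \sum_a f (gup a \qp gam a).
Proof.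
move=> lf; have -> : Delta = \sum_a vscale 1 (gup a \qp gam a).
  apply: eq_bigr => a _; apply/funext => i.
  by rewrite /vscale mul1r.
by rewrite slin_comb //; apply: eq_bigr => a _; rewrite mul1r.
Qed.

Lemma quad_prodC V W : is_vfield V -> is_vfield W -> quad_prod W V = quad_prod V W.
Proof. by move=> vV vW; rewrite /quad_prod (qprodC vW). Qed.

Lemma quad_splitC V W : is_vfield V -> is_vfield W -> quad_split W V = quad_split V W.
Proof.
move=> vV vW; rewrite /quad_split /tr4.
rewrite (dual_swap eta_sym (b := fun P Q =>
  \sum_b << W \qp P, V \qp Q, gup b, gam b >>_0)); [|by lin..].
by apply: eq_bigr => a _; apply: tr4C.
Qed.

Lemma quad_prod_swap V W : is_vfield V -> is_vfield W ->
  \sum_a tr4 (V \qp W \qp gam a) (gup a) = quad_prod V W.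
Proof.
move=> vV vW; rewrite /quad_prod /tr4.
by rewrite (dual_swap eta_sym (b := fun P Q =>
  \sum_b << V \qp W \qp P, Q, gup b, gam b >>_0)); [|by lin..].
Qed.

Lemma trace6_T V W : is_vfield V -> is_vfield W ->
  \sum_a \sum_b << T V, gam b \qp W, gup a, gam a, gup b >>_0 =
  quad_split V W + quad_shift V W + quad_prod V W.
Proof.
move=> vV vW; rewrite exchange_big /=.
transitivity (\sum_b (tr4 (gup b \qp V) (gam b \qp W)
   + << gup b, V, gam b \qp W, Delta >>_0 + tr4 (V \qp (gam b \qp W)) (gup b))).
  apply: eq_bigr => b _; rewrite -trace5_T //; apply: eq_bigr => a _.
  by corr_perm.
rewrite !big_split /=; congr (_ + _ + _).
- by apply: eq_bigr => b _; rewrite !(qprodC _ vV, qprodC _ vW).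
- apply: eq_bigr => b _; rewrite (qprodC _ vW) //.
  by corr_perm.
- rewrite -quad_prod_swap //; apply: eq_bigr => b _.
  by rewrite (qprodC _ vW) // qprodA.
Qed.

Lemma trace6_T2 V W : is_vfield V -> is_vfield W ->
  \sum_a \sum_b << T (gam b \qp V), W, gup a, gam a, gup b >>_0 =
  quad_Delta V W + quad_shift W V + quad_prod V W.
Proof.
move=> vV vW; rewrite exchange_big /=.
transitivity (\sum_b (tr4 (gup b \qp (gam b \qp V)) W
   + << gup b, gam b \qp V, W, Delta >>_0 + tr4 (gam b \qp V \qp W) (gup b))).
  apply: eq_bigr => b _; rewrite -trace5_T //; apply: eq_bigr => a _.
  by corr_perm.
rewrite !big_split /=; congr (_ + _ + _).
- rewrite /quad_Delta /tr4.
  rewrite (slin_Delta (f := fun X => \sum_a << V \qp X, W, gup a, gam a >>_0)).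
    apply: eq_bigr => b _; apply: eq_bigr => a _.
    by rewrite qprodA // (qprodC vV).
  by lin.
- apply: eq_bigr => b _; rewrite (qprodC _ vV) //.
  by corr_perm.
- rewrite -quad_prod_swap //; apply: eq_bigr => b _.
  by rewrite (qprodC _ vV) // qprodAC.
Qed.

Lemma trace6_qprod V W : is_vfield V -> is_vfield W ->
  \sum_a \sum_b (<< V \qp W \qp gup a, gam a, gup b, gam b >>_0
    + << qprod3 (gam b) (V \qp W) (gup a), gam a, gup b >>_0
    + << qprod3 (gam b) V W \qp gup a, gam a, gup b >>_0) =
  quad_prod V W + quad_cross V W + quad_pair V W.
Proof.
move=> vV vW; under eq_bigr do rewrite !big_split /=.
rewrite !big_split /=; congr (_ + _ + _).
- apply: eq_bigr => a _.
  rewrite (dual_swap eta_sym (b := fun P Q =>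
    << V \qp W, gup a, P, gam a \qp Q >>_0)); [|by lin..].
  apply: eq_bigr => b _; rewrite qprod3_pair //.
  by corr_perm.
- rewrite exchange_big /= /quad_pair.
  rewrite (dual_swap eta_sym (b := fun P Q =>
    << V, W, P, Delta \qp Q >>_0)); [|by lin..].
  apply: eq_bigr => b _.
  have -> : << V, W, gam b, Delta \qp gup b >>_0 =
      << gam b, V, W, Delta \qp gup b >>_0 by corr_perm.
  rewrite -qprod3_pair //.
  have -> : << qprod3 (gam b) V W, Delta, gup b >>_0 =
      << Delta, qprod3 (gam b) V W, gup b >>_0 by corr_perm.
  rewrite corr_Delta; apply: eq_bigr => a _.
  by rewrite qprodC // corr3_swap.
Qed.

Lemma quad6_TT V W : is_vfield V -> is_vfield W ->
  \sum_a \sum_b << T W, T V, gup a, gam a, gup b, gam b >>_0 =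
  (quad_split V W + quad_shift V W + quad_prod V W)
  + (quad_split V W + quad_shift W V + quad_prod V W)
  + (quad_prod V W + quad_cross V W + quad_pair V W) *+ 2.
Proof.
move=> vV vW; under eq_bigr do under eq_bigr do rewrite corr6_TT //.
under eq_bigr do rewrite big_split /= big_split /= sumrMnl.
rewrite big_split /= big_split /= sumrMnl trace6_qprod // trace6_T //.
by rewrite trace6_T // quad_splitC // quad_prodC.
Qed.

Lemma quad6_T2 V W : is_vfield V -> is_vfield W ->
  \sum_a \sum_b << T (T V), W, gup a, gam a, gup b, gam b >>_0 =
  (quad_Delta V W + quad_shift W V + quad_prod V W)
  + (quad_prod V W + quad_cross V W + quad_pair V W).
Proof.
move=> vV vW; under eq_bigr do under eq_bigr do rewrite corr6_T2 //.
under eq_bigr do rewrite big_split /=.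
by rewrite big_split /= trace6_qprod // trace6_T2.
Qed.

(** * Recursion in genus one *)

Hypothesis TRR1 : forall W, is_vfield W ->
  << T W >>_1 = (1 / 24) *: \sum_a << W, gup a, gam a >>_0.

Definition tr3 X : series := \sum_a << X, gup a, gam a >>_0.
Definition tr5 X Y Z : series := \sum_a << X, Y, Z, gup a, gam a >>_0.

Lemma vact_tr3 U X : is_vfield U -> is_vfield X ->
  vact U (tr3 X) = tr4 U X + tr3 (nabla U X).
Proof.
move=> vU vX; rewrite vact_sum // -big_split; apply: eq_bigr => a _.
by rewrite (vact_flat _ (Ws := [:: X]) (Cs := [:: gup a; gam a])) //= big_seq1.
Qed.

Lemma vact_tr4 U X Y : is_vfield U -> is_vfield X -> is_vfield Y ->
  vact U (tr4 X Y) = tr5 U X Y + tr4 (nabla U X) Y + tr4 X (nabla U Y).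
Proof.
move=> vU vX vY; rewrite vact_sum // -!big_split; apply: eq_bigr => a _.
rewrite (vact_flat _ (Ws := [:: X; Y]) (Cs := [:: gup a; gam a])) //=.
by rewrite !big_cons big_nil addr0 addrA.
Qed.

(** The derivative of TRR1 along X. *)
Lemma trr1_2 W X : is_vfield W -> is_vfield X ->
  << T W, X >>_1 = << W \qp X >>_1 + (1 / 24) *: tr4 W X.
Proof.
move=> vW vX; have := congr1 (vact X) (TRR1 vW).
rewrite (vact_flat _ (Ws := [:: T W]) (Cs := [::])) // vactZ //.
rewrite -/(tr3 W) vact_tr3 // /= big_seq1 corr_nabla_T // TRR1 // scalerDr.
rewrite (tr4C (X := X)) // (qprodC (U := X)) //.
have -> : << T W, X >>_1 = << X, T W >>_1 by corr_perm.
by move=> H; apply: (eq_of_sub H); rewrite /tr3; ring.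
Qed.

(** The derivative of trr1_2 along Y. *)
Lemma trr1_3 W X Y : is_vfield W -> is_vfield X -> is_vfield Y ->
  << T W, X, Y >>_1 = << Y \qp W, X >>_1 + << W \qp X, Y >>_1
    + << qprod3 Y W X >>_1 + (1 / 24) *: tr5 W X Y.
Proof.
move=> vW vX vY; have := congr1 (vact Y) (trr1_2 vW vX).
rewrite (vact_flat _ (Ws := [:: T W; X]) (Cs := [::])) // vactD // vactZ //.
rewrite (vact_flat _ (Ws := [:: W \qp X]) (Cs := [::])) // vact_tr4 //.
rewrite /= !big_cons !big_nil corr_nabla_T // !trr1_2 // !scalerDr.
rewrite corr_nabla_qprod //.
have -> : << T W, X, Y >>_1 = << Y, T W, X >>_1 by corr_perm.
have -> : << W \qp X, Y >>_1 = << Y, W \qp X >>_1 by corr_perm.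
have -> : tr5 W X Y = tr5 Y W X by apply: eq_bigr => a _; corr_perm.
by move=> H; apply: (eq_of_sub H); ring.
Qed.

Lemma tr4_T V X : is_vfield V -> is_vfield X -> tr4 (T V) X = tr3 (V \qp X).
Proof. by move=> vV vX; apply: eq_bigr => a _; rewrite trr4. Qed.

Lemma corr1_T2_2 V X : is_vfield V -> is_vfield X ->
  << T (T V), X >>_1 = (1 / 24) *: tr3 (V \qp X).
Proof.
by move=> vV vX; rewrite trr1_2 // TRR0 // corr_zero add0r tr4_T.
Qed.

Lemma corr1_T2_3 V X Y : is_vfield V -> is_vfield X -> is_vfield Y ->
  << T (T V), X, Y >>_1 = << V \qp X \qp Y >>_1 +
    (1 / 24) *: (tr4 (Y \qp V) X + << Y, V, X, Delta >>_0 + tr4 (V \qp X) Y).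
Proof.
move=> vV vX vY; rewrite trr1_3 // qprod_Tr // TRR0 // !corr_zero !add0r.
have -> : qprod3 Y (T V) X = qprod3 (T V) X Y.
  by apply: eq_qprod3 => a; corr_perm.
by rewrite qprod3_T // -trace5_T.
Qed.

(** * The derivative of A1 along T (T V) *)

Lemma qprod_pair u y x w :
  is_vfield u -> is_vfield y -> is_vfield x -> is_vfield w ->
  << u \qp y, x, w >>_0 = << u, y, x \qp w >>_0.
Proof.
move=> vu vy vx vw; rewrite corr_qprod.
have -> : << u, y, x \qp w >>_0 = << x \qp w, u, y >>_0 by corr_perm.
rewrite corr_qprod.
rewrite (dual_swap eta_sym (b := fun P Q => << u, y, P >>_0 * << Q, x, w >>_0));
  [|by lin..].
apply: eq_bigr => a _; rewrite mulrC.
have -> : << u, y, gam a >>_0 = << gam a, u, y >>_0 by corr_perm.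
by have -> : << gup a, x, w >>_0 = << x, w, gup a >>_0 by corr_perm.
Qed.

Lemma tr3_qprod X Y : is_vfield X -> is_vfield Y ->
  tr3 (X \qp Y) = << X, Y, Delta >>_0.
Proof.
move=> vX vY; have -> : << X, Y, Delta >>_0 = << Delta, X, Y >>_0 by corr_perm.
rewrite corr_Delta; apply: eq_bigr => a _; rewrite qprod_pair //.
by corr_perm.
Qed.

Lemma slin_qprod (f : vfield -> series) X Y : slin f ->
  f (X \qp Y) = \sum_a << X, Y, gup a >>_0 * f (gam a).
Proof. by move=> lf; rewrite qmul.unlock slin_comb. Qed.

Lemma slin_qprod_gup (f : vfield -> series) X Y :
  is_vfield X -> is_vfield Y -> slin f ->
  f (X \qp Y) = \sum_a << X, Y, gam a >>_0 * f (gup a).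
Proof.
move=> vX vY lf; rewrite slin_qprod //.
rewrite (dual_swap eta_sym (b := fun P Q => << X, Y, P >>_0 * f Q)) //.
  by move=> Z vZ; apply: slin_mulr; lin.
by move=> Z vZ; apply: slin_mull.
Qed.

Lemma qprod0l W : 0 \qp W = 0.
Proof. by rewrite qmul.unlock comb0 // => a; exact: corr_zero. Qed.

Lemma nabla_qprod_flat Z w W : is_vfield Z -> is_vfield W -> flat w ->
  nabla Z (w \qp W) = qprod3 Z w W + w \qp nabla Z W.
Proof.
move=> vZ vW fw; have vw := vfield_flat fw.
by rewrite nabla_qprod // (nabla_flat vZ fw) qprod0l addr0.
Qed.

Lemma corr_zero2 G A Ws : cor G [:: A, 0 : vfield & Ws] = 0.
Proof. by rewrite corr_cons; apply: fsum0 => i; rewrite corr_zero mulr0. Qed.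

(** The Leibniz rule applied to each of the five terms of A1: in the last sum of
    each right-hand side Z differentiates W, and these sums make up
    A1 (nabla Z W), which nabla_tensor subtracts. *)
Section Insertion.
Variables (Z W : vfield).
Hypotheses (vZ : is_vfield Z) (vW : is_vfield W).

Lemma nabla_A1_term1 :
  vact Z (\sum_a << gam a >>_1 * << gup a \qp W >>_1) =
  \sum_a << Z, gam a >>_1 * << gup a \qp W >>_1
  + \sum_a << gam a >>_1 * (<< Z, gup a \qp W >>_1 + << qprod3 Z (gup a) W >>_1)
  + \sum_a << gam a >>_1 * << gup a \qp nabla Z W >>_1.
Proof.
rewrite vact_sum // -!big_split; apply: eq_bigr => a _; rewrite vactM //.
rewrite (vact_flat _ (Ws := [::]) (Cs := [:: gam a])) // big_nil.
rewrite (vact_flat _ (Ws := [:: gup a \qp W]) (Cs := [::])) // big_seq1.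
by rewrite /= nabla_qprod_flat // corrD //; ring.
Qed.

Lemma nabla_A1_term2 :
  vact Z (\sum_a << gam a, gup a \qp W >>_1) =
  \sum_a (<< Z, gam a, gup a \qp W >>_1 + << gam a, qprod3 Z (gup a) W >>_1)
  + \sum_a << gam a, gup a \qp nabla Z W >>_1.
Proof.
rewrite vact_sum // -!big_split; apply: eq_bigr => a _.
have E X : is_vfield X -> << gam a, X >>_1 = << X, gam a >>_1 by corr_perm.
rewrite !E // (vact_flat _ (Ws := [:: gup a \qp W]) (Cs := [:: gam a])) //.
rewrite big_seq1 /= nabla_qprod_flat // corrD //.
have -> : << Z, gup a \qp W, gam a >>_1 = << Z, gam a, gup a \qp W >>_1 by corr_perm.
by ring.
Qed.

Lemma nabla_A1_term3 :
  vact Z (\sum_a << W, gam a \qp gup a >>_1) =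
  \sum_a (<< Z, W, gam a \qp gup a >>_1 + << W, qprod3 Z (gam a) (gup a) >>_1)
  + \sum_a << nabla Z W, gam a \qp gup a >>_1.
Proof.
rewrite vact_sum // -!big_split; apply: eq_bigr => a _.
rewrite (vact_flat _ (Ws := [:: W; gam a \qp gup a]) (Cs := [::])) //.
rewrite /= !big_cons big_nil nabla_qprod_flat // (nabla_flat vZ (flat_gup L eta a)).
by rewrite qprod0 // !addr0; ring.
Qed.

Lemma nabla_A1_term4 :
  vact Z (\sum_a \sum_b << W, gam a, gup a, gup b >>_0 * << gam b >>_1) =
  \sum_a \sum_b << Z, W, gam a, gup a, gup b >>_0 * << gam b >>_1
  + \sum_a \sum_b << W, gam a, gup a, gup b >>_0 * << Z, gam b >>_1
  + \sum_a \sum_b << nabla Z W, gam a, gup a, gup b >>_0 * << gam b >>_1.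
Proof.
rewrite vact_sum // -!big_split; apply: eq_bigr => a _.
rewrite vact_sum // -!big_split; apply: eq_bigr => b _; rewrite vactM //.
rewrite (vact_flat _ (Ws := [:: W]) (Cs := [:: gam a; gup a; gup b])) //.
rewrite (vact_flat _ (Ws := [::]) (Cs := [:: gam b])) // big_nil big_seq1 /=.
by ring.
Qed.

Lemma nabla_A1_term5 :
  vact Z (\sum_a \sum_b << W, gup a, gam a, gup b, gam b >>_0) =
  \sum_a \sum_b << Z, W, gup a, gam a, gup b, gam b >>_0
  + \sum_a \sum_b << nabla Z W, gup a, gam a, gup b, gam b >>_0.
Proof.
rewrite vact_sum // -!big_split; apply: eq_bigr => a _.
rewrite vact_sum // -!big_split; apply: eq_bigr => b _.
rewrite (vact_flat _ (Ws := [:: W]) (Cs := [:: gup a; gam a; gup b; gam b])) //.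
by rewrite big_seq1.
Qed.

End Insertion.

Section Evaluation.
Variables (V W : vfield).
Hypotheses (vV : is_vfield V) (vW : is_vfield W).
Notation g1 := << V \qp W \qp Delta >>_1.

Lemma sum_tr3_l :
  \sum_a tr3 (V \qp gam a) * << gup a \qp W >>_1 = g1.
Proof.
have -> : g1 = << V \qp Delta \qp W >>_1 by rewrite qprodAC.
rewrite (slin_qprod_gup (f := fun X => << X \qp W >>_1)) //; last by lin.
apply: eq_bigr => a _; rewrite tr3_qprod //; congr (_ * _).
by corr_perm.
Qed.

Lemma sum_tr3_r :
  \sum_a << gam a >>_1 * tr3 (V \qp (gup a \qp W)) = g1.
Proof.
rewrite corr_qprod; apply: eq_bigr => a _; rewrite mulrC; congr (_ * _).
rewrite (qprodC _ vW) // qprodA // tr3_qprod //.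
by corr_perm.
Qed.

Lemma sum_qprod_Delta (f : vfield -> series) X : is_vfield X -> slin f ->
  \sum_a f (X \qp gup a \qp gam a) = f (X \qp Delta).
Proof.
move=> vX lf; rewrite (slin_Delta (f := fun Y => f (X \qp Y))).
  by apply: eq_bigr => a _; rewrite qprodA.
apply: (slin_comp (phi := fun Y => X \qp Y) lf).
by lin.
Qed.

(** This lemma and the next three compute, for Z = T (T V), the sums of the first
    four lemmas nabla_A1_term in which Z is inserted; quad6_T2 computes that of
    the fifth. *)
Lemma A1_eval1 :
  \sum_a << T (T V), gam a >>_1 * << gup a \qp W >>_1
  + \sum_a << gam a >>_1 *
      (<< T (T V), gup a \qp W >>_1 + << qprod3 (T (T V)) (gup a) W >>_1) =
  (1 / 24) *: g1 + (1 / 24) *: g1.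
Proof.
rewrite -{1}sum_tr3_l -sum_tr3_r !scaler_sumr; congr (_ + _);
  apply: eq_bigr => a _; rewrite corr1_T2_2 //.
  by rewrite scalerAl.
by rewrite qprod3_T // TRR0 // qprod0l corr_zero addr0 scalerAr.
Qed.

Lemma A1_eval2 :
  \sum_a (<< T (T V), gam a, gup a \qp W >>_1
          + << gam a, qprod3 (T (T V)) (gup a) W >>_1) =
  g1 + (1 / 24) *: (quad_split V W + quad_shift V W + quad_prod V W).
Proof.
transitivity (\sum_a (<< V \qp W \qp gup a \qp gam a >>_1 + (1 / 24) *:
    (tr4 (V \qp gam a) (W \qp gup a) + << V, Delta, gam a, W \qp gup a >>_0
     + tr4 (V \qp W \qp gup a) (gam a)))).
  apply: eq_bigr => a _; rewrite qprod3_T // TRR0 // qprod0l corr_zero2 addr0.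
  have -> : << T (T V), gam a, gup a \qp W >>_1 =
    << T (T V), gup a \qp W, gam a >>_1 by corr_perm.
  rewrite corr1_T2_3 // (qprodC _ vV) // (qprodC _ vW) // qprodA //.
  have -> // : << gam a, V, W \qp gup a, Delta >>_0 =
    << V, Delta, gam a, W \qp gup a >>_0 by corr_perm.
rewrite !big_split /= (sum_qprod_Delta (f := fun X => << X >>_1)) //; last by lin.
congr (_ + _); rewrite -scaler_sumr !big_split /=; congr (_ *: (_ + _ + _)).
- rewrite -quad_splitC // /quad_split; apply: eq_bigr => a _.
  exact: tr4C.
- by rewrite -(dual_swap eta_sym (b := fun P Q =>
    << V, Delta, P, W \qp Q >>_0)); [|by lin..].
Qed.

Lemma A1_eval3 :
  \sum_a (<< T (T V), W, gam a \qp gup a >>_1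
          + << W, qprod3 (T (T V)) (gam a) (gup a) >>_1) =
  g1 + (1 / 24) *: (quad_Delta V W + << V, W, Delta, Delta >>_0
                    + tr4 (V \qp W) Delta).
Proof.
transitivity (<< T (T V), W, Delta >>_1).
  rewrite (slin_Delta (f := fun X => << T (T V), W, X >>_1)); last by lin.
  apply: eq_bigr => a _; rewrite qprod3_T // TRR0 // qprod0l corr_zero2 addr0.
  by rewrite qprodC.
rewrite corr1_T2_3 // (qprodC _ vV) //.
by have -> : << Delta, V, W, Delta >>_0 = << V, W, Delta, Delta >>_0 by corr_perm.
Qed.

Lemma A1_eval4 :
  \sum_a \sum_b << T (T V), W, gam a, gup a, gup b >>_0 * << gam b >>_1
  + \sum_a \sum_b << W, gam a, gup a, gup b >>_0 * << T (T V), gam b >>_1 =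
  g1 + (1 / 24) *: quad_Delta V W.
Proof.
congr (_ + _).
  rewrite -(sum_qprod_Delta (f := fun X => << X >>_1)) //; last by lin.
  apply: eq_bigr => a _; rewrite corr_qprod; apply: eq_bigr => b _.
  congr (_ * _); rewrite -corr5_T2 //.
  by corr_perm.
rewrite /quad_Delta /tr4 scaler_sumr; apply: eq_bigr => a _.
rewrite (slin_qprod_gup (f := fun X => << X, W, gup a, gam a >>_0)) //; last by lin.
rewrite scaler_sumr; apply: eq_bigr => b _.
rewrite corr1_T2_2 // tr3_qprod // -scalerAr.
rewrite [X in _ *: X]mulrC.
have -> : << V, gam b, Delta >>_0 = << V, Delta, gam b >>_0 by corr_perm.
have -> // : << W, gam a, gup a, gup b >>_0 = << gup b, W, gup a, gam a >>_0.
by corr_perm.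
Qed.

(** * The tensor A2 at (T W, T V) *)

Lemma corr1_T_qDelta X Y : is_vfield X -> is_vfield Y ->
  << T X, Y \qp Delta >>_1 = << X \qp Y \qp Delta >>_1 + (1 / 24) *: quad_Delta Y X.
Proof.
move=> vX vY; rewrite trr1_2 // qprodA //; congr (_ + _ *: _).
exact: tr4C.
Qed.

(** The numbers are the positions of the sums in A2; the third, seventh and
    eleventh are the second, sixth and tenth with V and W exchanged, and the
    last one is quad6_TT. *)
Lemma A2_eval1 : \sum_a \sum_b
  << T W, T V, gup a, gup b >>_0 * << gam a >>_1 * << gam b >>_1 = 0.
Proof.
rewrite big1 // => a _; rewrite big1 // => b _.
by rewrite trr4 // qprod_Tr // corr_zero !mul0r.
Qed.

Lemma A2_eval2 X Y : is_vfield Y ->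
  \sum_a << X, gup a >>_1 * << gam a \qp T Y >>_1 = 0.
Proof.
by move=> vY; rewrite big1 // => a _; rewrite qprod_Tr // corr_zero mulr0.
Qed.

Lemma A2_eval4 : \sum_a << T W \qp T V, gup a >>_1 * << gam a >>_1 = 0.
Proof. by rewrite big1 // => a _; rewrite TRR0 // corr_zero mul0r. Qed.

Lemma A2_eval5 :
  \sum_a \sum_b << T W, T V, gup a, gam a, gup b >>_0 * << gam b >>_1 = g1 + g1.
Proof.
rewrite -(sum_qprod_Delta (f := fun X => << X >>_1)) //; last by lin.
rewrite -big_split; apply: eq_bigr => a _; rewrite !corr_qprod -big_split.
by apply: eq_bigr => b _; rewrite corr5_TT // mulrDl.
Qed.

Lemma A2_eval6 X Y : is_vfield X -> is_vfield Y ->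
  \sum_a \sum_b << T X, gup a, gam a, gup b >>_0 * << gam b, T Y >>_1 =
  << Y \qp X \qp Delta >>_1 + (1 / 24) *: quad_Delta X Y.
Proof.
move=> vX vY; rewrite -corr1_T_qDelta //.
have -> : << T Y, X \qp Delta >>_1 = << X \qp Delta, T Y >>_1 by corr_perm.
rewrite -(sum_qprod_Delta (f := fun P => << P, T Y >>_1)) //; last by lin.
apply: eq_bigr => a _; rewrite corr_qprod.
by apply: eq_bigr => b _; rewrite trr4.
Qed.

Lemma A2_eval8 :
  \sum_a << T W, T V, gup a \qp gam a >>_1 =
  g1 + (1 / 24) *: quad_Delta W V + g1
  + (1 / 24) *: (quad_Delta V W + << V, W, Delta, Delta >>_0 + tr4 (V \qp W) Delta).
Proof.
transitivity << T W, T V, Delta >>_1.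
  by rewrite (slin_Delta (f := fun X => << T W, T V, X >>_1)); last by lin.
rewrite trr1_3 // qprod_Tr // corr_zero addr0.
have -> : << Delta \qp W, T V >>_1 = << T V, W \qp Delta >>_1.
  by rewrite qprodC //; corr_perm.
rewrite corr1_T_qDelta //.
have -> : qprod3 Delta W (T V) = qprod3 (T V) W Delta.
  by apply: eq_qprod3 => a; corr_perm.
rewrite qprod3_T //; congr (_ + _ *: _).
transitivity (\sum_a << T V, W, Delta, gup a, gam a >>_0).
  by apply: eq_bigr => a _; corr_perm.
rewrite trace5_T // (qprodC (U := Delta)) //.
by have -> : << Delta, V, W, Delta >>_0 = << V, W, Delta, Delta >>_0 by corr_perm.
Qed.

Lemma A2_eval9 : \sum_a \sum_b
  << T W, T V, gup a, gup b >>_0 * << gam a, gam b >>_1 = 0.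
Proof.
rewrite big1 // => a _; rewrite big1 // => b _.
by rewrite trr4 // qprod_Tr // corr_zero mul0r.
Qed.

Lemma A2_eval10 X Y : is_vfield X -> is_vfield Y ->
  \sum_a << gam a, gup a \qp T X, Y >>_1 = 0.
Proof.
by move=> vX vY; rewrite big1 // => a _; rewrite qprod_Tr // corr_zero2.
Qed.

Lemma A2_eval12 : \sum_a << T W \qp T V, gam a, gup a >>_1 = 0.
Proof. by rewrite big1 // => a _; rewrite TRR0 // corr_zero. Qed.

End Evaluation.

End GenusZero.

(** * Comparison of A2 with the derivative of A1 *)

Section RationalIdentity.
Variables (K : numFieldType) (A : comAlgType K).

(** The coefficient of g is 5 / 24 on both sides, and the rest agrees modulo the
    five relations, taken with multipliers 2, -16, 12, -7 and 4 over the common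
    denominator 5760 = 240 * 24. *)
Lemma rational_identity (g b1 b2 b3 b3' b4 b5 b6 b6' b7 b8 : A) :
  b1 + b3' = b6 + b8 -> b1 + b3 = b6' + b8 -> b1 + b2 = b6 + b6' ->
  b2 + b2 = b7 + b7 -> b4 = b5 ->
    (23 / 240) *: (g + g)
  + (1 / 48) *: (g + (1 / 24 : K) *: b3')
  + (1 / 48) *: (g + (1 / 24 : K) *: b3)
  - (1 / 80) *: (g + (1 / 24 : K) *: b3' + g + (1 / 24 : K) *: (b3 + b1 + b2))
  + (1 / 576) *: (b5 + b6 + b4 + (b5 + b6' + b4) + (b4 + b7 + b8) *+ 2) =
    (7 / 10) *: ((1 / 24 : K) *: g + (1 / 24 : K) *: g)
  + (1 / 10) *: (g + (1 / 24 : K) *: (b5 + b6 + b4))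
  - (1 / 240) *: (g + (1 / 24 : K) *: (b3 + b1 + b2))
  + (13 / 240) *: (g + (1 / 24 : K) *: b3)
  + (1 / 960) *: (b3 + b6' + b4 + (b4 + b7 + b8)).
Proof.
move=> r1 r2 r3 r4 r5.
have [q qE] : {q : K | q = 1 / 240} by exists (1 / 240).
have [p pE] : {p : K | p = 1 / 24} by exists (1 / 24).
have alg (c : K) : {z : A | forall x, c *: x = z * x}.
  by exists c%:A => x; rewrite mulr_algl.
have [[z zE] [t tE]] := (alg q, alg p).
have S1 (c : K) m : c = m%:R * q -> forall x : A, c *: x = (z * x) *+ m.
  by move=> -> x; rewrite -zE -[RHS]scaler_nat scalerA.
have S2 (c : K) m : c = m%:R * (q * p) ->
    forall x : A, c *: x = (z * (t * x)) *+ m.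
  by move=> -> x; rewrite -zE -tE -[RHS]scaler_nat !scalerA mulrA.
have e1 : 23 / 240 = 23%:R * q :> K by rewrite qE; field.
have e2 : 1 / 48 = 5%:R * q :> K by rewrite qE; field.
have e3 : 1 / 80 = 3%:R * q :> K by rewrite qE; field.
have e4 : 7 / 10 * (1 / 24) = 7%:R * q :> K by rewrite qE; field.
have e5 : 1 / 10 = 24%:R * q :> K by rewrite qE; field.
have e6 : 1 / 240 = 1%:R * q :> K by rewrite qE; field.
have e7 : 13 / 240 = 13%:R * q :> K by rewrite qE; field.
have f1 : 1 / 576 = 10%:R * (q * p) :> K by rewrite qE pE; field.
have f2 : 1 / 960 = 6%:R * (q * p) :> K by rewrite qE pE; field.
rewrite -[X in (7 / 10) *: X]scalerDr scalerA.
rewrite !(S1 _ _ e1) !(S1 _ _ e2) !(S1 _ _ e3) !(S1 _ _ e4)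
  !(S1 _ _ e5) !(S1 _ _ e6) !(S1 _ _ e7)
  !(S2 _ _ f1) !(S2 _ _ f2).
rewrite -pE !tE.
have H : z * (t * ((b1 + b3') *+ 2 - (b1 + b3) *+ 16 + (b1 + b2) *+ 12
    - (b2 + b2) *+ 7 + b4 *+ 4)) =
  z * (t * ((b6 + b8) *+ 2 - (b6' + b8) *+ 16 + (b6 + b6') *+ 12
    - (b7 + b7) *+ 7 + b5 *+ 4)) by rewrite r1 r2 r3 r4 r5.
apply: (eq_of_sub H).
by ring.
Qed.
End RationalIdentity.

Section GenusTwo.
Variables (K : numFieldType) (L : comAlgType K) (n : nat).
Variables (eta : 'M[K]_n.+1) (F : nat -> fps L (bps n)).
Notation series := (fps L (bps n)).
Notation vfield := (bps n -> series).
Notation "'<<' W , .. , V '>>_' g" := (cor (F g%N) (cons W .. (cons V nil) ..))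
  (at level 0, W at level 99, V at level 99, g at level 0).
Notation "U \qp W" := (qmul eta F U W) (at level 40, left associativity).
Notation gup := (gup L eta).
Notation gam := (gam L).
Notation T := (trr_op eta F).
Notation A1 := (A1 eta F).
Notation A2 := (A2 eta F).
Implicit Types (U V W X Y Z w x y z u : vfield) (f g : series).

Lemma corE : @corr K L n = cor. Proof. by rewrite cor.unlock. Qed.

Lemma qprodE : Defs.qprod eta F = qmul eta F.
Proof. by rewrite qmul.unlock cor.unlock. Qed.

Lemma TE : Defs.T eta F = T.
Proof. by rewrite trr_op.unlock cor.unlock. Qed.

Lemma slin_A2 V : is_vfield V -> slin (fun W => A2 W V).
Proof. by move=> vV; rewrite /Defs.A2 corE qprodE; lin. Qed.

Lemma A2C V W : is_vfield V -> is_vfield W -> A2 V W = A2 W V.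
Proof.
move=> vV vW; rewrite /Defs.A2 corE qprodE (qprodC _ _ vV vW).
under [X in (13 / 10) *: X]eq_bigr do under eq_bigr do rewrite (corr_swap _ _ vV vW).
under [X in (23 / 240) *: X]eq_bigr do under eq_bigr do rewrite (corr_swap _ _ vV vW).
under [X in (1 / 80) *: X]eq_bigr do rewrite (corr_swap _ _ vV vW).
under [X in (7 / 30) *: X]eq_bigr do under eq_bigr do rewrite (corr_swap _ _ vV vW).
under [X in (1 / 576) *: X]eq_bigr do under eq_bigr do rewrite (corr_swap _ _ vV vW).
by ring.
Qed.

Hypotheses (eta_sym : eta^T = eta) (eta_unit : eta \in unitmx).
Hypothesis TRR0 : forall W V, is_vfield W -> is_vfield V -> T W \qp V = 0.
Hypothesis TRR1 : forall W, is_vfield W ->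
  << T W >>_1 = (1 / 24) *: \sum_a << W, gup a, gam a >>_0.

Notation Delta := (Delta eta F).
Notation g1 V W := << V \qp W \qp Delta >>_1.
Notation a1 V W := << V, W, Delta, Delta >>_0.
Notation a2 V W := (tr4 eta F (V \qp W) Delta).
Notation a3 V W := (quad_Delta eta F V W).
Notation a4 V W := (quad_prod eta F V W).
Notation a5 V W := (quad_split eta F V W).
Notation a6 V W := (quad_shift eta F V W).
Notation a7 V W := (quad_cross eta F V W).
Notation a8 V W := (quad_pair eta F V W).

Lemma A2_TT_eval V W : is_vfield V -> is_vfield W ->
  A2 (T W) (T V) =
    (23 / 240) *: (g1 V W + g1 V W)
  + (1 / 48) *: (g1 V W + (1 / 24) *: a3 W V)
  + (1 / 48) *: (g1 V W + (1 / 24) *: a3 V W)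
  - (1 / 80) *: (g1 V W + (1 / 24) *: a3 W V + g1 V W
                 + (1 / 24) *: (a3 V W + a1 V W + a2 V W))
  + (1 / 576) *: (a5 V W + a6 V W + a4 V W + (a5 V W + a6 W V + a4 V W)
                  + (a4 V W + a7 V W + a8 V W) *+ 2).
Proof.
move=> vV vW; have vD := vfield_Delta eta F.
rewrite /Defs.A2 corE qprodE A2_eval1 // (A2_eval2 TRR0) // (A2_eval2 TRR0) //.
rewrite A2_eval4 // A2_eval5 // !A2_eval6 // A2_eval8 // A2_eval9 //.
rewrite !A2_eval10 // A2_eval12 // quad6_TT // (qprodC eta F vW vV).
by rewrite !scaler0; ring.
Qed.

Lemma nabla_A1_T2_eval V W : is_vfield V -> is_vfield W ->
  nabla_tensor A1 (T (T V)) W =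
    (7 / 10) *: ((1 / 24) *: g1 V W + (1 / 24) *: g1 V W)
  + (1 / 10) *: (g1 V W + (1 / 24) *: (a5 V W + a6 V W + a4 V W))
  - (1 / 240) *: (g1 V W + (1 / 24) *: (a3 V W + a1 V W + a2 V W))
  + (13 / 240) *: (g1 V W + (1 / 24) *: a3 V W)
  + (1 / 960) *: (a3 V W + a6 W V + a4 V W + (a4 V W + a7 V W + a8 V W)).
Proof.
move=> vV vW; have vZ : is_vfield (T (T V)) by [].
rewrite /nabla_tensor /Defs.A1 corE qprodE.
rewrite !vactD ?vactN ?vactZ //.
rewrite nabla_A1_term1 // nabla_A1_term2 // nabla_A1_term3 //.
rewrite nabla_A1_term4 // nabla_A1_term5 //.
rewrite A1_eval1 // A1_eval2 // A1_eval3 // A1_eval4 // quad6_T2 //.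
set C1 := \sum_a _ * _; set C2 := \sum_a _; set C3 := \sum_a _.
set C4 := \sum_a _; set C5 := \sum_a _.
rewrite !(scalerDr _ _ C1) !(scalerDr _ _ C2) !(scalerDr _ _ C3).
rewrite !(scalerDr _ _ C4) !(scalerDr _ _ C5).
by ring.
Qed.

Lemma A2_TT V W : is_vfield V -> is_vfield W ->
  A2 (T W) (T V) = nabla_tensor A1 (T (T V)) W.
Proof.
move=> vV vW; rewrite A2_TT_eval // nabla_A1_T2_eval //.
apply: rational_identity.
- exact: (quad_rel1 eta_sym eta_unit TRR0 vV vW).
- exact: (quad_rel2 eta_sym eta_unit TRR0 vV vW).
- exact: (quad_rel3 eta_sym eta_unit TRR0 vV vW).
- exact: (quad_rel4 eta_sym eta_unit TRR0 V W).
- exact: (quad_rel5 eta_sym eta_unit TRR0 vV vW).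
Qed.

(** * Decomposition along the string field *)

Definition tau_down W : vfield := fun i => W (i.1.+1, i.2).

Lemma vfield_tau_down W : is_vfield W -> is_vfield (tau_down W).
Proof.
move=> /summableP vW; apply/summableP => m; have [A AP] := vW m.
exists [fset ((i.1.-1, i.2) : bps n) | i in A]%fset => -[k a] kA.
apply: AP; apply: contraNN kA => kA.
by apply/imfsetP; exists (k.+1, a).
Qed.

Notation S := (string_vf L (n := n)).

Lemma vfield_S : is_vfield S.
Proof. exact: string_is_vfield. Qed.

Lemma fderiv_fvar (i j : bps n) : fderiv i (fvar L j) = (i == j)%:R.
Proof.
apply/fpsP => m; rewrite /=; case: (eqVneq i j) => [->|nij].
  rewrite coef1; case: (eqVneq m mset0) => [->|nm].
    by rewrite msetD0 eqxx mset0E.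
  rewrite (_ : _ == _ = false) ?mul0rn //; apply/negbTE.
  apply: contra nm => /eqP/msetP E; apply/eqP/msetP => c.
  have := E c; rewrite mset1DE mset0E msetnE.
  by case: (c == j); case: (m c).
rewrite coef0 (_ : _ == _ = false) ?mul0rn //; apply/negbTE/eqP => /msetP/(_ i).
by rewrite mset1DE eqxx msetnE (negbTE nij).
Qed.

Lemma vact_fvar U (j : bps n) : is_vfield U -> vact U (fvar L j) = U j.
Proof.
move=> vU; apply: fps_eqP => m.
apply: (agree_trans (g := \sum_(i <- [fset j]%fset) U i * fderiv i (fvar L j))).
  apply: fsum_agree => i; rewrite in_fset1 fderiv_fvar => /negbTE ->.
  by move=> a _; rewrite mulr0.
by rewrite big_seq_fset1 fderiv_fvar eqxx mulr1.
Qed.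

Lemma nabla_S U : is_vfield U -> nabla U S = - tau_down U.
Proof.
move=> vU; apply/funext => -[k a].
rewrite /nabla /string_vf vactN // /ttilde vactD // vactN //.
rewrite (_ : vact U (_)%:R = 0); last by case: (_ && _); rewrite ?vact1 ?vact0.
by rewrite subr0 [vact _ _]vact_fvar.
Qed.

Hypothesis string0 : << S >>_0 =
  (1 / 2) *: \sum_a \sum_b eta a b *: (tcoord L 0 a * tcoord L 0 b).

(** The derivative of the string equation along W, where nabla W S is
    - tau_down W. *)
Lemma string_derivative W : is_vfield W ->
  << S, W >>_0 = << tau_down W >>_0
    + \sum_a \sum_b eta a b *: (tcoord L 0 a * W (0%N, b)).
Proof.
move=> vW; have vS := vfield_S; have vd := vfield_tau_down vW.
have E (c : K) (x x' y y' s t : series) : x = x' -> y = y' ->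
    c *: (x * t + s * y) = c *: (x' * t + s * y') by move=> -> ->.
set q := \sum_a _.
have dq : vact W (\sum_a \sum_b eta a b *: (tcoord L 0 a * tcoord L 0 b)) = q + q.
  transitivity (\sum_a \sum_b (eta a b *: (W (0%N, a) * tcoord L 0 b)
                               + eta a b *: (tcoord L 0 a * W (0%N, b)))).
    rewrite vact_sum //; apply: eq_bigr => a _; rewrite vact_sum //.
    apply: eq_bigr => b _; rewrite vactZ // vactM // -scalerDr.
    have Ea : vact W (tcoord L 0 a) = W (0%N, a) by exact: vact_fvar.
    have Eb : vact W (tcoord L 0 b) = W (0%N, b) by exact: vact_fvar.
    exact: (E _ _ _ _ _ _ _ Ea Eb).
  under eq_bigr do rewrite big_split.
  rewrite big_split /= exchange_big /=; congr (_ + _).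
  apply: eq_bigr => b _; apply: eq_bigr => a _.
  by rewrite mulrC -{1}eta_sym mxE.
have := congr1 (vact W) string0.
rewrite (vact_flat _ (Ws := [:: S]) (Cs := [::])) // big_seq1 /= nabla_S //.
rewrite corrN // vactZ // dq => H.
rewrite (corr_swap _ _ vS vW); apply: (eq_of_sub H).
rewrite -mulr2n -scaler_nat scalerA div1r mulVf ?pnatr_eq0 // scale1r.
by ring.
Qed.

Lemma comb_coefS (h : 'I_n.+1 -> series) k a :
  (\sum_c vscale (h c) (gam c) : vfield) (k.+1, a) = 0.
Proof.
rewrite fct_sumE big1 // => c _.
by rewrite /vscale /Defs.gam xpair_eqE /= mulr0.
Qed.

Lemma tau_down_gup a : tau_down (gup a) = 0.
Proof.
apply/funext => -[k b]; rewrite /tau_down gup_comb.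
exact: comb_coefS.
Qed.

Lemma string_product W c : is_vfield W ->
  << S, W, gup c >>_0 = << tau_down W, gup c >>_0 + W (0%N, c).
Proof.
move=> vW; have vS := vfield_S; have vd := vfield_tau_down vW.
have fc := flat_gup L eta c.
have E (d : K) (x x' y y' s t : series) : x = x' -> y = y' ->
    d *: (x * t + s * y) = d *: (x' * t + s * y') by move=> -> ->.
pose q (f f' : 'I_n.+1 -> series) := \sum_a \sum_b eta a b *: (f a * f' b).
have dq : vact (gup c) (q (tcoord L 0) (fun b => W (0%N, b))) =
    q (fun a => gup c (0%N, a)) (fun b => W (0%N, b)) +
    q (tcoord L 0) (fun b => nabla (gup c) W (0%N, b)).
  rewrite /q vact_sum // -big_split; apply: eq_bigr => a _.
  rewrite vact_sum // -big_split; apply: eq_bigr => b _.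
  rewrite vactZ // vactM // /= -scalerDr.
  have Ea : vact (gup c) (tcoord L 0 a) = gup c (0%N, a) by exact: vact_fvar.
  exact: (E _ _ _ _ _ _ _ Ea (erefl _)).
have qW : q (fun a => gup c (0%N, a)) (fun b => W (0%N, b)) = W (0%N, c).
  rewrite /q exchange_big /=.
  transitivity (\sum_b (c == b)%:R *: W (0%N, b)).
    apply: eq_bigr => b _; have /matrixP/(_ c b) := mulVmx eta_unit.
    rewrite !mxE => <-; rewrite scaler_suml; apply: eq_bigr => a _.
    by rewrite gup_comb comb_coef -scalerAl mul1r scalerA mulrC.
  rewrite (bigD1 c) //= eqxx scale1r big1 ?addr0 // => b.
  by rewrite eq_sym => /negbTE ->; rewrite scale0r.
have := congr1 (vact (gup c)) (string_derivative vW).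
rewrite (vact_flat _ (Ws := [:: S; W]) (Cs := [::])) // vactD //.
rewrite (vact_flat _ (Ws := [:: tau_down W]) (Cs := [::])) //.
rewrite dq qW /= !big_cons !big_nil nabla_S // tau_down_gup oppr0 corr_zero.
rewrite string_derivative // -/(q _ (fun b => nabla (gup c) W (0%N, b))).
rewrite -[nabla (gup c) (tau_down W)]/(tau_down (nabla (gup c) W)).
have -> : << S, W, gup c >>_0 = << gup c, S, W >>_0 by corr_perm.
have -> : << tau_down W, gup c >>_0 = << gup c, tau_down W >>_0 by corr_perm.
by move=> H; apply: (eq_of_sub H); ring.
Qed.

(** The string field is a unit for the product up to the image of T: by
    string_product its product with W is the primary part of W minus that of
    T (tau_down W), and T (tau_down W) has the other components of W. *)
Lemma string_decomposition W : is_vfield W ->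
  W = S \qp W + T (tau_down W).
Proof.
move=> vW; rewrite qmul.unlock trr_op.unlock.
under eq_bigr do rewrite string_product //.
rewrite combD addrC addrA subrK; apply/funext => -[[|k] a].
  by rewrite [RHS]/= -[RHS]/(0 + _) comb_coef add0r.
rewrite -[RHS]/(W (k.+1, a) + (\sum_c vscale (W (0%N, c)) (gam c) : vfield) (k.+1, a)).
by rewrite comb_coefS addr0.
Qed.

(** * The recursion relations of genus two *)

Hypothesis TRR_I : forall W, is_vfield W -> << T (T W) >>_2 = A1 W.
Hypothesis relation_star : forall W1 W2 V,
  is_vfield W1 -> is_vfield W2 -> is_vfield V ->
  B eta F W1 W2 (T V) = A2 (W1 \qp W2) V - nabla_tensor A1 (W1 \qp W2) V.
Hypothesis TRR_III : forall W1 W2 W3,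
  is_vfield W1 -> is_vfield W2 -> is_vfield W3 ->
    2 *: << W1 \qp W2 \qp W3 >>_2
  - 2 *: (\sum_a << W1, W2, W3, gup a >>_0 * << T (gam a) >>_2)
  + (<< W1, T (W2 \qp W3) >>_2 - << T W1, W2 \qp W3 >>_2)
  + (<< W2, T (W1 \qp W3) >>_2 - << T W2, W1 \qp W3 >>_2)
  + (<< W3, T (W1 \qp W2) >>_2 - << T W3, W1 \qp W2 >>_2)
  = B eta F W1 W2 W3.

Lemma T0 : T 0 = 0.
Proof.
rewrite trr_op.unlock comb0 ?subr0 => [|a]; last exact: corr_zero.
by apply/funext => -[[|k] a].
Qed.

(** The derivative of the first recursion relation along U, since
    nabla U (T (T V)) = T (T (nabla U V)) - T (U \qp V). *)
Lemma corr2_T2 U V : is_vfield U -> is_vfield V ->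
  << U, T (T V) >>_2 = nabla_tensor A1 U V + << T (U \qp V) >>_2.
Proof.
move=> vU vV; have := congr1 (vact U) (TRR_I vV).
rewrite (vact_flat _ (Ws := [:: T (T V)]) (Cs := [::])) // big_seq1 /=.
rewrite corr_nabla_T // qprod_Tr // corr_zero subr0 nabla_T // T_add // T_opp //.
rewrite corrB // TRR_I // /nabla_tensor => H.
by apply: (eq_of_sub H); ring.
Qed.

(** The third recursion relation at W3 = T V, where all the products with T V
    drop out, combined with corr2_T2. *)
Lemma TRR_II_qprod W1 W2 V : is_vfield W1 -> is_vfield W2 -> is_vfield V ->
  << T (W1 \qp W2), T V >>_2 - 3 *: << T (W1 \qp W2 \qp V) >>_2 = A2 (W1 \qp W2) V.
Proof.
move=> vW1 vW2 vV; have := TRR_III vW1 vW2 (vfield_T eta F vV).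
rewrite relation_star // !qprod_Tr // T0 !corr_zero !corr_zero2 !scaler0.
have -> : \sum_a << W1, W2, T V, gup a >>_0 * << T (gam a) >>_2 =
    << T (W1 \qp W2 \qp V) >>_2.
  have -> : W1 \qp W2 \qp V = V \qp W1 \qp W2.
    by rewrite qprodC // (qprodA eta_unit TRR0).
  rewrite (slin_qprod _ _ (f := fun X => << T X >>_2)); last by lin.
  apply: eq_bigr => a _; rewrite -(trr4 eta_unit TRR0) //; last exact: flat_gup.
  by congr (_ * _); corr_perm.
have -> : << T (T V), W1 \qp W2 >>_2 = << W1 \qp W2, T (T V) >>_2 by corr_perm.
have -> : << T V, T (W1 \qp W2) >>_2 = << T (W1 \qp W2), T V >>_2 by corr_perm.
rewrite corr2_T2 // !scaler_nat => H.
by apply: (eq_of_sub H); ring.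
Qed.

Definition defect W V : series :=
  << T W, T V >>_2 - 3 *: << T (W \qp V) >>_2 - A2 W V.

Lemma defectC W V : is_vfield W -> is_vfield V -> defect W V = defect V W.
Proof.
move=> vW vV; rewrite /defect (qprodC _ _ vW vV) (A2C vW vV).
by have -> : << T W, T V >>_2 = << T V, T W >>_2 by corr_perm.
Qed.

Lemma slin_defect V : is_vfield V -> slin (fun W => defect W V).
Proof.
move=> vV; apply: slin_add; last exact/slin_opp/slin_A2.
by lin.
Qed.

Lemma defect_qprod W1 W2 V : is_vfield W1 -> is_vfield W2 -> is_vfield V ->
  defect (W1 \qp W2) V = 0.
Proof. by move=> vW1 vW2 vV; rewrite /defect TRR_II_qprod // subrr. Qed.

Lemma defect_T V W : is_vfield V -> is_vfield W -> defect (T W) (T V) = 0.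
Proof.
move=> vV vW; rewrite /defect A2_TT // qprod_Tr // T0 corr_zero scaler0 subr0.
have -> : << T (T W), T (T V) >>_2 = << T (T V), T (T W) >>_2 by corr_perm.
by rewrite corr2_T2 // TRR0 // T0 corr_zero addr0 subrr.
Qed.

(** Both arguments are decomposed along the string field; linearity and symmetry
    leave only the pairs of the two preceding lemmas. *)
Lemma defect_eq0 V W : is_vfield V -> is_vfield W -> defect W V = 0.
Proof.
move=> vV vW; have vS := vfield_S.
have vV' := vfield_tau_down vV; have vW' := vfield_tau_down vW.
have defectD A A' X : is_vfield A -> is_vfield A' -> is_vfield X ->
    defect (A + A') X = defect A X + defect A' X.
  by move=> vA vA' vX; apply: (slin_defect vX).1.
rewrite (string_decomposition vW) defectD // defect_qprod // add0r.
rewrite defectC // (string_decomposition vV) defectD // defect_qprod // add0r.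
exact: defect_T.
Qed.

End GenusTwo.

Local Open Scope complex_scope.

Theorem theorem2p9 (R : realType) (L : comAlgType R[i]) (n : nat)
    (eta : 'M[R[i]]_n.+1) (F : nat -> fps L (bps n)) :
  eta^T = eta -> eta \in unitmx ->
  string_equation eta F ->
  dilaton_equation F ->
  genus0_TRR eta F ->
  genus1_TRR eta F ->
  genus1_relation eta F ->
  genus2_TRR_I eta F ->
  genus2_TRR_III eta F ->
  genus2_TRR_II eta F.
Proof.
move=> eta_sym eta_unit string _ TRR0 TRR1 star TRR_I TRR_III W V vW vV.
move: (string 0%N) TRR0 TRR1 star TRR_I TRR_III.
rewrite /genus0_TRR /genus1_TRR /genus1_relation /genus2_TRR_I /genus2_TRR_III.
rewrite corE qprodE TE /= => string0 TRR0 TRR1 star TRR_I TRR_III.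
by apply/eqP; rewrite -subr_eq0 -/(defect eta F W V); apply/eqP/defect_eq0.
Qed.
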